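(* There are absolute constants $C,C'>0$ such that the following holds. For each $n$, let $X=(\xi_1,\dots,\xi_n)$ be a random vector in $\mathbb{C}^n$ whose coordinates $\xi_i$ are independent random variables with mean $0$ and variance $1$ (the distributions may depend on $n$). Let $K=K(n)>1$, put $\xi_i'=\xi_i\mathbf{1}_{|\xi_i|\le K}$, let $\mu_i$ and $\sigma_i^2$ be the mean and variance of $\xi_i'$, and set $$\varepsilon_1=\max_{1\le i\le n}\mathbf{P}(|\xi_i|>K),\qquad \varepsilon_2=\max_{1\le i\le n}|\mu_i|,\qquad \varepsilon_3=\max_{1\le i\le n}|\sigma_i^2-1|.$$ Assume $\varepsilon_1,\varepsilon_2,\varepsilon_3\le 1/2$ and that $n^2K^2(\varepsilon_2+\varepsilon_3)=o(1)$ as $n\to\infty$. Then for all sufficiently large $n$, every nonzero matrix $A\in\mathbb{C}^{n\times n}$ and every $t>0$, $$\mathbf{P}(|X^*AX-\operatorname{trace}(A)|\ge t)\le C\log n\,\exp\left(-C'K^{-2}\min\left\{\frac{t^2}{\|A\|_F^2\log n},\frac{t}{\|A\|_2}\right\}\right)+n\varepsilon_1.$$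
   Context: $\|A\|_F$ and $\|A\|_2$ denote the Frobenius norm and the spectral (operator) norm of $A$. For a complex random variable $\xi$ with mean $\mu$, its variance is $\mathbf{E}|\xi-\mu|^2$. $\mathbf{1}_E$ denotes the indicator of the event $E$. *)

(* Defs.v *)
From HB Require Import structures.
From mathcomp Require Import all_boot all_order all_algebra.
From mathcomp Require Import all_classical all_reals all_analysis.
From mathcomp Require Import complex.

Set Implicit Arguments.
Unset Strict Implicit.
Unset Printing Implicit Defensive.

Import Order.TTheory GRing.Theory Num.Theory.
Import numFieldNormedType.Exports.

Local Open Scope classical_set_scope.
Local Open Scope ring_scope.
Local Open Scope complex_scope.
Local Open Scope sesquilinear_scope.

Notation cabs := ComplexField.Normc.normc.

Section complex_borel.
Context {R : realType}.

(* The Borel sigma-algebra of C, transported from the product sigma-algebra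
   of R * R along the identification (x, y) |-> x + iy. *)
Definition cmeasurable : set (set R[i]) :=
  [set B | measurable [set p : R * R | B (p.1 +i* p.2)]].

Lemma cmeasurable0 : cmeasurable set0.
Proof. exact: (@measurable0 _ (R * R)%type). Qed.

Lemma cmeasurableC B : cmeasurable B -> cmeasurable (~` B).
Proof. by move=> mB; exact: (measurableC mB). Qed.

Lemma cmeasurable_bigcup (F : (set R[i])^nat) :
  (forall k, cmeasurable (F k)) -> cmeasurable (\bigcup_k F k).
Proof. by move=> mF; exact: (bigcup_measurable (fun k _ => mF k)). Qed.

HB.instance Definition _ := isPointed.Build R[i] 0.

HB.instance Definition _ := isMeasurable.Build default_measure_display R[i]
  cmeasurable0 cmeasurableC cmeasurable_bigcup.

End complex_borel.

Section complex_random_variables.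
Context {d : measure_display} {T : measurableType d} {R : realType}.
Variable P : probability T R.

(* [fine] sends infinite integrals to 0, so [cexpectation] is meaningful for
   integrable variables only.  If [cvariance X] is finite then X is square
   integrable, hence integrable, and [cexpectation X] is its genuine mean. *)
Definition cexpectation (X : T -> R[i]) : R[i] :=
  fine ('E_P[fun w => complex.Re (X w)]) +i* fine ('E_P[fun w => complex.Im (X w)]).

Definition cvariance (X : T -> R[i]) : \bar R :=
  'E_P[fun w => cabs (X w - cexpectation X) ^+ 2].

Definition independent_RVs d' (T' : measurableType d') (I : finType)
    (X : I -> {RV P >-> T'}) : Prop :=
  forall (J : {set I}) (B : I -> set T'), (forall i, measurable (B i)) ->
    P (\bigcap_(i in [set` J]) (X i @^-1` B i)) =
    (\prod_(i in J) P (X i @^-1` B i))%E.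

Definition truncation (K : R) (X : T -> R[i]) : T -> R[i] :=
  fun w => X w * (\1_[set w' | cabs (X w') <= K] w)%:C.

Section epsilons.
Variables (n : nat) (X : 'I_n -> T -> R[i]) (K : R).

(* The maxima are over nonnegative quantities, so the default value 0 only
   matters when n = 0. *)
Definition eps1 : R :=
  \big[Num.max/0]_(i < n) fine (P [set w | K < cabs (X i w)]).

Definition eps2 : R :=
  \big[Num.max/0]_(i < n) cabs (cexpectation (truncation K (X i))).

Definition eps3 : R :=
  \big[Num.max/0]_(i < n) `|fine (cvariance (truncation K (X i))) - 1|.

End epsilons.

End complex_random_variables.

Section matrix_norms.
Context {R : realType}.

Definition frobenius_norm m n (A : 'M[R[i]]_(m, n)) : R :=
  Num.sqrt (\sum_i \sum_j cabs (A i j) ^+ 2).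

(* On column vectors [frobenius_norm] is the Euclidean norm. *)
Definition spectral_norm m n (A : 'M[R[i]]_(m, n)) : R :=
  sup [set frobenius_norm (A *m v) | v in
        [set v : 'cV[R[i]]_n | frobenius_norm v <= 1]].

Definition quad_form n (A : 'M[R[i]]_n) (v : 'cV[R[i]]_n) : R[i] :=
  (v ^t* *m A *m v) 0 0.

End matrix_norms.

(* Main.v *)
Require Import Defs.
From HB Require Import structures.
From mathcomp Require Import all_boot all_order all_algebra.
From mathcomp Require Import all_classical all_reals all_analysis.
From mathcomp Require Import measurable_realfun complex.
From mathcomp Require Import ring lra.

Set Implicit Arguments.
Unset Strict Implicit.
Unset Printing Implicit Defensive.

Import Order.TTheory GRing.Theory Num.Theory.
Import numFieldNormedType.Exports.

Local Open Scope classical_set_scope.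
Local Open Scope ring_scope.

(** Why the theorem holds.

    Off an event of probability at most n eps1 the vector X equals its
    truncation Y, whose coordinates are bounded by K, almost centred and almost
    of unit variance.  For Y the exponential moment of a Hermitian form is
    bounded directly:

      E exp (Y^H B Y) <= exp (tr B + 18 K^2 |B|_F^2 + n delta)

    as soon as |v^H B v| <= |v|^2 / (72 K^2) for every vector v, with
    delta <= eps2 + eps3 ([mgf_qform]).  A Chernoff bound for the real and
    imaginary parts of Y^H A Y - tr A then gives the tail, with the scale K^2
    in front of both the Gaussian and the exponential regime
    ([truncated_chernoff]).  The growth condition makes n delta at most 1 for
    large n, and ln n >= 1 turns the resulting bound into the stated one.

    The exponential moment is computed by integrating out one coordinate at a
    time.  Write B in blocks B_0, b, u where u is the last diagonal entry.
    With the other coordinates y fixed, the last one, xi, enters through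
    2 Re (conj xi l) + u |xi|^2 with l = b^H y.  As xi is bounded by K and has
    almost mean 0 and variance 1, this factor has expectation at most
    exp (u + 18 K^2 u^2 + 18 K^2 |l|^2 + delta) ([mgf_scalar]): the linear part
    costs K^2 |l|^2 as in Hoeffding's lemma, whereas the quadratic part costs u
    itself, because the variance is 1, up to second order in u.  Since
    |l|^2 = y^H b b^H y, what remains is the exponential of a Hermitian form in
    one variable less, with matrix B_0 + g b b^H where g = 18 K^2
    ([elim_last]).

    Two facts make this recursion close up without any loss.  The spectral
    bound survives: when 2 g t <= 1, inserting y_last = g l into
    v^H B v <= t |v|^2 bounds the new form by the same t
    ([form_bounded_elim]).  And the potential tr B + g |B|_F^2 pays for each
    step: the increase g |b|^2 of the trace is covered by the 2 g |b|^2 that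
    the off-diagonal entries contribute to g |B|_F^2 ([potential_elim]). *)

Local Notation Re := complex.Re.
Local Notation Im := complex.Im.
Local Notation "z ^*" := (conjc z) : ring_scope.

(** * Elimination of one variable from a Hermitian form *)

Section hermitian_elimination.
Variable R : rcfType.
Local Notation C := R[i].
Local Open Scope complex_scope.

Definition sqmod (z : C) : R := Re z ^+ 2 + Im z ^+ 2.

Lemma sqmod_ge0 z : 0 <= sqmod z.
Proof. by rewrite addr_ge0// sqr_ge0. Qed.

Lemma sqmod0 : sqmod 0 = 0.
Proof. by rewrite /sqmod /= expr0n addr0. Qed.

Lemma sqmodM y z : sqmod (y * z) = sqmod y * sqmod z.
Proof. by case: y z => [a b] [c e]; rewrite /sqmod /=; ring. Qed.

Lemma sqmodJ z : sqmod z^* = sqmod z.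
Proof. by case: z => a b; rewrite /sqmod /= sqrrN. Qed.

Lemma sqmod_real (a : R) : sqmod a%:C = a ^+ 2.
Proof. by rewrite /sqmod /= expr0n addr0. Qed.

Lemma mulJc z : z^* * z = (sqmod z)%:C.
Proof. by case: z => a b; rewrite /sqmod; simpc; congr (_ +i* _); ring. Qed.

Lemma conjcM (y z : C) : (y * z)^* = y^* * z^*.
Proof. exact: rmorphM. Qed.

Lemma conjcD (y z : C) : (y + z)^* = y^* + z^*.
Proof. exact: rmorphD. Qed.

Lemma conjcR (a : R) : (a%:C)^* = a%:C.
Proof. by rewrite /conjc /= oppr0. Qed.

Lemma conjc_sum I (r : seq I) (P : pred I) (F : I -> C) :
  (\sum_(i <- r | P i) F i)^* = \sum_(i <- r | P i) (F i)^*.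
Proof. exact: rmorph_sum. Qed.

Lemma ReD (y z : C) : Re (y + z) = Re y + Re z.
Proof. by case: y z => [a b] [c e]. Qed.

Lemma ReN (z : C) : Re (- z) = - Re z.
Proof. by case: z. Qed.

Lemma ReJ (z : C) : Re z^* = Re z.
Proof. by case: z. Qed.

Lemma ReZ (a : R) (z : C) : Re (a%:C * z) = a * Re z.
Proof. by case: z => b c; rewrite /= mul0r subr0. Qed.

Lemma Re_sum I (r : seq I) (P : pred I) (F : I -> C) :
  Re (\sum_(i <- r | P i) F i) = \sum_(i <- r | P i) Re (F i).
Proof. by elim/big_rec2: _ => // i y1 y2 _ <-; rewrite ReD. Qed.

(** Matrices and vectors are indexed by all of nat, and the dimension k only
    bounds the sums; removing the last variable then needs no change of
    type. *)
Definition qform k (B : nat -> nat -> C) (v : nat -> C) : R :=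
  Re (\sum_(i < k) \sum_(j < k) (v i)^* * B i j * v j).

Definition sqnorm k (v : nat -> C) : R := \sum_(i < k) sqmod (v i).

Definition rtrace k (B : nat -> nat -> C) : R := \sum_(i < k) Re (B i i).

Definition frob2 k (B : nat -> nat -> C) : R :=
  \sum_(i < k) \sum_(j < k) sqmod (B i j).

Definition rowdot k (B : nat -> nat -> C) (v : nat -> C) : C :=
  \sum_(j < k) B k j * v j.

Definition hermitian (B : nat -> nat -> C) := forall i j, B j i = (B i j)^*.

(** This is B_0 + g b b^H, where b is the last column of B. *)
Definition elim_last (g : R) k (B : nat -> nat -> C) : nat -> nat -> C :=
  fun i j => B i j + g%:C * (B i k * B k j).

Definition form_bounded (t : R) k B := forall v, `|qform k B v| <= t * sqnorm k v.

Lemma eq_qform k B v w : (forall i, (i < k)%N -> v i = w i) ->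
  qform k B v = qform k B w.
Proof.
move=> vw; congr Re; apply: eq_bigr => i _; apply: eq_bigr => j _.
by rewrite !vw.
Qed.

Lemma eq_rowdot k B v w : (forall i, (i < k)%N -> v i = w i) ->
  rowdot k B v = rowdot k B w.
Proof. by move=> vw; apply: eq_bigr => i _; rewrite vw. Qed.

Lemma eq_sqnorm k v w : (forall i, (i < k)%N -> v i = w i) ->
  sqnorm k v = sqnorm k w.
Proof. by move=> vw; apply: eq_bigr => i _; rewrite vw. Qed.

Lemma sqnormS k v : sqnorm k.+1 v = sqnorm k v + sqmod (v k).
Proof. by rewrite /sqnorm big_ord_recr. Qed.

Lemma sqnorm_ge0 k v : 0 <= sqnorm k v.
Proof. by apply: sumr_ge0 => i _; exact: sqmod_ge0. Qed.

Lemma hermitian_elim_last g k B : hermitian B -> hermitian (elim_last g k B).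
Proof.
move=> hB i j; rewrite /elim_last conjcD !conjcM conjcR -!hB.
by rewrite (mulrC (B j k)).
Qed.

Lemma hermitian_diag B i : hermitian B -> B i i = (Re (B i i))%:C.
Proof.
move=> /(_ i i); case: (B i i) => a b [] /= /eqP.
by rewrite -addr_eq0 -mulr2n mulrn_eq0 /= => /eqP ->.
Qed.

Lemma qformS k B v : hermitian B ->
  qform k.+1 B v = qform k B v + 2 * Re ((v k)^* * rowdot k B v)
                   + Re (B k k) * sqmod (v k).
Proof.
move=> hB; rewrite /qform big_ord_recr /=.
under eq_bigr do rewrite big_ord_recr /=.
rewrite big_split /= big_ord_recr /= !ReD.
have -> : \sum_(i < k) (v i)^* * B i k * v k = ((v k)^* * rowdot k B v)^*.
  rewrite /rowdot mulr_sumr conjc_sum; apply: eq_bigr => i _.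
  by rewrite !conjcM conjcK -hB; ring.
rewrite ReJ /rowdot.
have -> : \sum_(i < k) (v k)^* * B k i * v i =
    (v k)^* * (\sum_(i < k) B k i * v i).
  by rewrite mulr_sumr; apply: eq_bigr => i _; rewrite mulrA.
rewrite (hermitian_diag k hB) -mulrA (mulrC _ (v k)) mulrA mulJc.
rewrite (mulrC (sqmod _)%:C) ReZ /=; ring.
Qed.

Lemma qform_elim g k B v : hermitian B ->
  qform k (elim_last g k B) v = qform k B v + g * sqmod (rowdot k B v).
Proof.
move=> hB; rewrite /qform /elim_last.
under eq_bigr => i _ do under eq_bigr => j _ do rewrite mulrDr mulrDl.
under eq_bigr => i _ do rewrite big_split /=.
rewrite big_split /= ReD; congr (_ + _).
transitivity (Re (g%:C * ((rowdot k B v)^* * rowdot k B v))); last first.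
  by rewrite mulJc ReZ.
congr Re; rewrite /rowdot conjc_sum mulr_suml mulr_sumr.
apply: eq_bigr => i _; rewrite !mulr_sumr; apply: eq_bigr => j _.
rewrite conjcM -hB; ring.
Qed.

Lemma rtraceS k B : rtrace k.+1 B = rtrace k B + Re (B k k).
Proof. by rewrite /rtrace big_ord_recr. Qed.

Lemma rtrace_elim g k B : hermitian B ->
  rtrace k (elim_last g k B) = rtrace k B + g * sqnorm k (B^~ k).
Proof.
move=> hB; rewrite /rtrace /sqnorm mulr_sumr -big_split /=.
by apply: eq_bigr => i _; rewrite ReD ReZ (hB i k) (mulrC (B i k)) mulJc.
Qed.

Lemma frob2S k B : hermitian B ->
  frob2 k.+1 B = frob2 k B + 2 * sqnorm k (B^~ k) + Re (B k k) ^+ 2.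
Proof.
move=> hB; rewrite /frob2 /sqnorm big_ord_recr /=.
under eq_bigr do rewrite big_ord_recr /=.
rewrite big_split /= big_ord_recr /= {1}(hermitian_diag k hB) sqmod_real.
have -> : \sum_(i < k) sqmod (B k i) = \sum_(i < k) sqmod (B i k).
  by apply: eq_bigr => i _; rewrite (hB i k) sqmodJ.
ring.
Qed.

Lemma frob2_elim g k B : hermitian B ->
  frob2 k (elim_last g k B) =
  frob2 k B + 2 * g * qform k B (B^~ k) + g ^+ 2 * sqnorm k (B^~ k) ^+ 2.
Proof.
move=> hB.
have sqmodD y z : sqmod (y + g%:C * z) =
    sqmod y + 2 * g * Re (y^* * z) + g ^+ 2 * sqmod z.
  case: y z => [a b] [c e]; rewrite /sqmod /=; ring.
rewrite /frob2 /elim_last.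
under eq_bigr => i _ do under eq_bigr => j _ do rewrite sqmodD.
under eq_bigr => i _ do rewrite 2!big_split /= -mulr_sumr -mulr_sumr.
rewrite 2!big_split /= -!mulr_sumr; congr (_ + _ * _ + _ * _).
  rewrite /qform exchange_big /= Re_sum; apply: eq_bigr => i _.
  rewrite Re_sum; apply: eq_bigr => j _.
  by rewrite (hB j i) (hB i k); congr Re; ring.
rewrite expr2 /sqnorm mulr_suml; apply: eq_bigr => i _.
rewrite mulr_sumr; apply: eq_bigr => j _.
by rewrite sqmodM (hB j k) sqmodJ.
Qed.

(** The bounds below follow by inserting suitable last coordinates into the
    bound of the form in k+1 variables. *)
Section bounded_form.
Variables (g t : R) (k : nat) (B : nat -> nat -> C).
Hypotheses (hB : hermitian B) (tB : form_bounded t k.+1 B).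

Let u := Re (B k k).
Let b := B^~ k.

Let tB_ext v z : `|qform k B v + 2 * Re (z^* * rowdot k B v) + u * sqmod z|
  <= t * (sqnorm k v + sqmod z).
Proof.
pose w i := if i == k then z else v i.
have wv i : (i < k)%N -> w i = v i by rewrite /w => /ltn_eqF ->.
have := tB w; rewrite qformS// sqnormS (eq_qform _ wv) (eq_rowdot _ wv).
by rewrite (eq_sqnorm wv) {1 2 3}/w eqxx.
Qed.

Lemma form_bounded_diag : `|Re (B k k)| <= t.
Proof.
(* This is the basis vector of the last coordinate. *)
have := tB_ext (fun=> 0) 1.
have -> : qform k B (fun=> 0) = 0.
  rewrite /qform big1// => i _; rewrite big1// => j _; exact: mulr0.
have -> : rowdot k B (fun=> 0) = 0 by rewrite /rowdot big1// => *; exact: mulr0.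
have -> : sqnorm k (fun=> 0) = 0 by rewrite /sqnorm big1// => *; exact: sqmod0.
rewrite /sqmod /= !(mulr0, mul0r, subr0, addr0, add0r, expr1n, expr0n, mulr1).
by rewrite oppr0 mulr0 add0r.
Qed.

Lemma form_bounded_restrict : form_bounded t k B.
Proof.
by move=> v; have := tB_ext v 0; rewrite sqmod0 conjc0 mul0r /= !mulr0 !addr0.
Qed.

(** Completing the square: the last coordinate g l changes the value of the
    form by 2 g |l|^2 + u g^2 |l|^2 and the squared norm by g^2 |l|^2; as
    |u| <= t, what is gained exceeds g |l|^2 when 2 g t <= 1.  The lower bound
    is immediate, since g b b^H is nonnegative. *)
Lemma form_bounded_elim : 0 <= g -> 2 * g * t <= 1 ->
  form_bounded t k (elim_last g k B).
Proof.
move=> g0 gt v; rewrite qform_elim// ler_norml; apply/andP; split.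
  have := form_bounded_restrict v; rewrite ler_norml => /andP[+ _].
  by have := mulr_ge0 g0 (sqmod_ge0 (rowdot k B v)); lra.
have := tB_ext v (g%:C * rowdot k B v).
rewrite sqmodM sqmod_real conjcM conjcR -mulrA mulJc ReZ /=.
rewrite ler_norml => /andP[_].
have := form_bounded_diag; rewrite ler_norml -/u => /andP[ut _].
set l := sqmod _; have l0 : 0 <= l by exact: sqmod_ge0.
set q := qform _ _ _; set N := sqnorm _ _ => H.
have gut : 0 <= g * (u + t) by apply: mulr_ge0 => //; lra.
have : 0 <= g * l * (1 + g * (u - t)).
  by apply: mulr_ge0; [exact: mulr_ge0|lra].
by rewrite expr2 in H; lra.
Qed.

(** Up to the constant this says that a column of B is at most as long as the
    norm of B; it is read off from the vector (s b, 1), with s = 1 / (2 t). *)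
Lemma form_bounded_col : 0 < t -> sqnorm k b <= 4 * t ^+ 2.
Proof.
move=> t0; pose s := (2 * t)^-1; have st : s * t = 1 / 2 by rewrite /s; field; lra.
have s0 : 0 < s by rewrite invr_gt0; lra.
set N := sqnorm k b; have N0 : 0 <= N by exact: sqnorm_ge0.
pose v i := s%:C * b i.
have sv : sqnorm k v = s ^+ 2 * N.
  by rewrite /sqnorm mulr_sumr; apply: eq_bigr => i _; rewrite sqmodM sqmod_real.
have := form_bounded_restrict v; rewrite sv ler_norml => /andP[qv _].
have := tB_ext v 1; rewrite conjc1 mul1r sv.
have -> : rowdot k B v = (s * N)%:C.
  rewrite /rowdot rmorphM rmorph_sum mulr_sumr; apply: eq_bigr => i _ /=.
  by rewrite /v (hB i k) mulrCA mulJc.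
rewrite /= {1 2}/sqmod /= expr1n expr0n addr0 !mulr1 ler_norml => /andP[_ h].
have := form_bounded_diag; rewrite ler_norml -/u => /andP[ut _].
have : 2 * (s * N) <= 2 * (s * t * s * N) + 2 * t by nra.
rewrite st => h1; have : (s * t) * N <= 2 * t ^+ 2 by nra.
by rewrite st; nra.
Qed.

(** The new trace exceeds tr B_0 by g |b|^2, and the new squared Frobenius norm
    exceeds |B_0|_F^2 by 2 g b^H B_0 b + g^2 |b|^4, which is at most
    (1/2 + 1/4) |b|^2 because g t <= 1/4.  Both are covered by the 2 |b|^2 of
    the off-diagonal entries of B. *)
Lemma potential_elim : 0 < g -> 4 * g * t <= 1 -> 0 < t ->
  Re (B k k) + g * Re (B k k) ^+ 2 +
    (rtrace k (elim_last g k B) + g * frob2 k (elim_last g k B)) <=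
  rtrace k.+1 B + g * frob2 k.+1 B.
Proof.
move=> g0 gt t0; rewrite rtrace_elim// frob2_elim// rtraceS frob2S//.
have := form_bounded_restrict b; rewrite ler_norml => /andP[_].
have := form_bounded_col t0; have : 0 <= sqnorm k b by exact: sqnorm_ge0.
rewrite -/b; set N := sqnorm k b; set q := qform _ _ _ => N0 Nt qt.
have gN : 0 <= g * N by apply: mulr_ge0 => //; exact: ltW.
have h1 : 2 * (g * q) <= N / 2.
  have : g * q <= g * t * N by rewrite -mulrA ler_wpM2l// ltW.
  by nra.
have h2 : (g ^+ 2 * N) * N <= N / 4.
  rewrite mulrC -subr_ge0 (_ : _ - _ = N * (1 / 4 - g ^+ 2 * N)); last by ring.
  apply: mulr_ge0 => //.
  have : g ^+ 2 * N <= g ^+ 2 * (4 * t ^+ 2) by rewrite ler_wpM2l// sqr_ge0.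
  have : (g * t) ^+ 2 <= (1 / 4) ^+ 2.
    by rewrite ler_pXn2r// ?nnegrE; [lra|apply: mulr_ge0; exact: ltW|lra].
  by rewrite exprMn; nra.
rewrite -subr_ge0 (_ : _ - _ =
  g * (N - 2 * (g * q) - (g ^+ 2 * N) * N)); last by ring.
by apply: mulr_ge0; [exact: ltW|lra].
Qed.

End bounded_form.

End hermitian_elimination.

(** * Exponential moment of one truncated variable *)

Section exponential_bounds.
Variable R : realType.
Implicit Types x p q : R.

Lemma expR_le_quadratic x : x <= 1 / 2 -> expR x <= 1 + x + 2 * x ^+ 2.
Proof.
move=> x2; have x1 : 0 < 1 - x by lra.
rewrite -(ler_pM2r x1); apply: (@le_trans _ _ 1).
  have := expR_ge1Dx (- x); rewrite expRN => h.
  by rewrite mulrC -ler_pdivlMr ?expR_gt0// div1r.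
rewrite -subr_ge0 (_ : _ - _ = x ^+ 2 * (1 - 2 * x)); last by ring.
by apply: mulr_ge0; [exact: sqr_ge0|lra].
Qed.

(** The Taylor bound and the trivial bound x <= 2 x^2 cover the two ranges of
    x.  The summand x makes this sharp for centred variables: it yields
    Hoeffding's bound with a worse constant. *)
Lemma expR_le_id_gauss x : expR x <= x + expR (2 * x ^+ 2).
Proof.
have [x2|x2] := leP x (1 / 2).
  have := expR_le_quadratic x2; have := expR_ge1Dx (2 * x ^+ 2); lra.
have : expR x <= expR (2 * x ^+ 2) by rewrite ler_expR; nra.
lra.
Qed.

(** Cauchy-Schwarz for E exp (p + q) in pointwise form: if a and b are chosen
    so that E exp (2 p) <= exp (2 a) and E exp (2 q) <= exp (2 b), then the
    right-hand side has expectation at most exp (a + b). *)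
Lemma expRD_le_mean p q (a b : R) : expR (p + q) <=
  expR (a + b) / 2 * (expR (2 * p - 2 * a) + expR (2 * q - 2 * b)).
Proof.
have -> : expR (p + q) = expR (a + b) * (expR (p - a) * expR (q - b)).
  by rewrite -!expRD; congr expR; ring.
rewrite -mulrA ler_pM2l ?expR_gt0//.
have sq (y z : R) : expR (2 * y - 2 * z) = expR (y - z) ^+ 2.
  by rewrite expr2 -expRD; congr expR; ring.
have := sqr_ge0 (expR (p - a) - expR (q - b)); rewrite !sq; nra.
Qed.

End exponential_bounds.

Section bounded_expectation.
Context {d : measure_display} {T : measurableType d} {R : realType}.
Variable P : probability T R.

Lemma integrable_bounded (f : T -> R) (M : R) : measurable_fun setT f ->
  (forall w, `|f w| <= M) -> P.-integrable setT (EFin \o f).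
Proof.
move=> mf fM; apply: measurable_bounded_integrable => //.
  by apply: le_lt_trans (probability_le1 P measurableT) (ltry 1).
by exists M; split; [exact: num_real|move=> N MN w _; exact: le_trans (ltW MN)].
Qed.

(** An exponential of a bounded variable will be dominated by an affine function
    of its squared modulus and of its real and imaginary parts, so that only
    the first two moments enter. *)
Lemma integral_le_affine (f s x y : T -> R) (c0 c1 c2 c3 M : R) :
  measurable_fun setT f -> measurable_fun setT s ->
  measurable_fun setT x -> measurable_fun setT y ->
  (forall w, `|s w| <= M) -> (forall w, `|x w| <= M) ->
  (forall w, `|y w| <= M) ->
  (forall w, 0 <= f w <= c0 + c1 * s w + c2 * x w + c3 * y w) ->
  (\int[P]_w (f w)%:E <=
   (c0 + c1 * \int[P]_w s w + c2 * \int[P]_w x w + c3 * \int[P]_w y w)%:E)%E.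
Proof.
move=> mf ms mx my sM xM yM fle.
have int c (g : T -> R) : measurable_fun setT g -> (forall w, `|g w| <= M) ->
    P.-integrable setT (EFin \o (fun w => c * g w)).
  move=> mg gM; apply: (@integrable_bounded _ (`|c| * M)).
    by apply: measurable_funM.
  by move=> w; rewrite normrM ler_wpM2l.
have int0 : P.-integrable setT (EFin \o (fun _ : T => c0)).
  by apply: (@integrable_bounded _ `|c0|).
have ints c (g : T -> R) (h : T -> R) : measurable_fun setT g ->
    (forall w, `|g w| <= M) -> P.-integrable setT (EFin \o h) ->
    P.-integrable setT (EFin \o (fun w => h w + c * g w)).
  by move=> mg gM ih; exact: integrableD ih (int c g mg gM).
have i1 := ints c1 s _ ms sM int0.
have i2 := ints c2 x _ mx xM i1.
have i3 := ints c3 y _ my yM i2.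
have intg (g : T -> R) : measurable_fun setT g -> (forall w, `|g w| <= M) ->
    P.-integrable setT (EFin \o g).
  by move=> mg gM; exact: integrable_bounded gM.
rewrite -(RintegralZl c1 measurableT (intg s ms sM)).
rewrite -(RintegralZl c2 measurableT (intg x mx xM)).
rewrite -(RintegralZl c3 measurableT (intg y my yM)).
have -> : c0 = \int[P]_w c0.
  rewrite Rintegral_cst// -[LHS]mulr1; congr (_ * _).
  exact/esym/(congr1 fine (probability_setT P)).
rewrite -RintegralD//; last exact: int.
rewrite -RintegralD//; last exact: int.
rewrite -RintegralD//; last exact: int.
rewrite fineK; last exact: integrable_fin_num i3.
apply: ge0_le_integral => //.
- by move=> w _; rewrite lee_fin; case/andP: (fle w).
- exact/measurable_EFinP.
- exact: measurable_int i3.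
- by move=> w _; rewrite lee_fin; case/andP: (fle w).
Qed.

End bounded_expectation.

Section complex_measurability.
Context {d : measure_display} {S : measurableType d} {R : realType}.

(** Componentwise measurability is what integrals of real-valued expressions
    need, and it also applies on spaces with a smaller sigma-algebra. *)
Definition cmeasurable_fun (f : S -> R[i]) :=
  measurable_fun setT (fun w => Re (f w)) /\
  measurable_fun setT (fun w => Im (f w)).

Implicit Types f g : S -> R[i].

Lemma cmeasurable_cst c : cmeasurable_fun (fun=> c).
Proof. by split; exact: measurable_cst. Qed.

Lemma cmeasurableD f g : cmeasurable_fun f -> cmeasurable_fun g ->
  cmeasurable_fun (fun w => f w + g w).
Proof.
move=> [f1 f2] [g1 g2]; split.
  rewrite (_ : (fun w => _) = (fun w => Re (f w)) \+ (fun w => Re (g w))); last first.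
    by apply/funext => w /=; case: (f w) (g w) => [? ?] [? ?].
  exact: measurable_funD.
rewrite (_ : (fun w => _) = (fun w => Im (f w)) \+ (fun w => Im (g w))); last first.
  by apply/funext => w /=; case: (f w) (g w) => [? ?] [? ?].
exact: measurable_funD.
Qed.

Lemma cmeasurableM f g : cmeasurable_fun f -> cmeasurable_fun g ->
  cmeasurable_fun (fun w => f w * g w).
Proof.
move=> [f1 f2] [g1 g2]; split.
  rewrite (_ : (fun w => _) = (fun w => Re (f w)) \* (fun w => Re (g w))
      \- (fun w => Im (f w)) \* (fun w => Im (g w)));
    last by apply/funext => w /=; case: (f w) (g w) => [? ?] [? ?].
  by apply: measurable_funB; exact: measurable_funM.
rewrite (_ : (fun w => _) = (fun w => Re (f w)) \* (fun w => Im (g w))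
    \+ (fun w => Im (f w)) \* (fun w => Re (g w)));
  last by apply/funext => w /=; case: (f w) (g w) => [? ?] [? ?].
by apply: measurable_funD; exact: measurable_funM.
Qed.

Lemma cmeasurableJ f : cmeasurable_fun f -> cmeasurable_fun (fun w => (f w)^*).
Proof.
move=> [f1 f2]; split.
  rewrite (_ : (fun w => _) = (fun w => Re (f w)))//.
  by apply/funext => w /=; case: (f w).
rewrite (_ : (fun w => _) = \- (fun w => Im (f w))); first exact: measurable_funN.
by apply/funext => w /=; case: (f w).
Qed.

Lemma cmeasurable_sum I (r : seq I) (Q : pred I) (F : I -> S -> R[i]) :
  (forall i, Q i -> cmeasurable_fun (F i)) ->
  cmeasurable_fun (fun w => \sum_(i <- r | Q i) F i w).
Proof.
move=> mF; have -> : (fun w => \sum_(i <- r | Q i) F i w) =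
    \big[(fun f g w => f w + g w)/fun=> 0]_(i <- r | Q i) F i.
  apply/funext => w; elim/big_rec2: _ => // i x f _ ->//.
by apply: (big_ind cmeasurable_fun) => //; exact: cmeasurableD.
Qed.

Lemma measurable_sqmod f : cmeasurable_fun f ->
  measurable_fun setT (fun w => sqmod (f w)).
Proof.
by move=> [f1 f2]; apply: measurable_funD; exact: measurable_funX.
Qed.

End complex_measurability.

Lemma cmeasurable_comp d1 d2 (S1 : measurableType d1) (S2 : measurableType d2)
    (R : realType) (g : S1 -> S2) (f : S2 -> R[i]) :
  measurable_fun setT g -> cmeasurable_fun f -> cmeasurable_fun (f \o g).
Proof.
move=> mg [f1 f2]; split; first exact: (measurableT_comp f1 mg).
exact: (measurableT_comp f2 mg). Qed.

Lemma cmeasurable_id (R : realType) : cmeasurable_fun (@id R[i]).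
Proof.
split=> _ B mB; rewrite setTI.
  suff : measurable [set p : R * R | B p.1] by [].
  by rewrite -[X in measurable X]setTI; exact: measurable_fst.
suff : measurable [set p : R * R | B p.2] by [].
by rewrite -[X in measurable X]setTI; exact: measurable_snd.
Qed.

Lemma abs_ReIm_le (R : realType) (z : R[i]) (r : R) : sqmod z <= r ->
  `|Re z| <= 1 + r /\ `|Im z| <= 1 + r.
Proof.
rewrite /sqmod => zr; have aux (a : R) : `|a| <= 1 + a ^+ 2.
  by rewrite -real_normK ?num_real//; have := normr_ge0 a; nra.
have := sqr_ge0 (Re z); have := sqr_ge0 (Im z).
by have := aux (Re z); have := aux (Im z); split; lra.
Qed.

Section scalar_mgf.
Context {d : measure_display} {T : measurableType d} {R : realType}.
Variable P : probability T R.

(** Both u |Y|^2 and the linear term are exponentiated separately.  The first is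
    small, |u| K^2 <= 1/4, so its exponential is affine in |Y|^2 up to a term
    u^2 |Y|^4 <= u^2 K^2 |Y|^2 of order K^2 u^2.  The second may be large and
    is handled by [expR_le_id_gauss]; its mean is not exactly 0, and the
    product of this mean and l is split between K^2 |l|^2 and d2. *)
Lemma mgf_scalar (Y : T -> R[i]) (K u d1 d2 : R) (l : R[i]) :
  cmeasurable_fun Y -> 1 <= K -> (forall w, sqmod (Y w) <= K ^+ 2) ->
  `|\int[P]_w sqmod (Y w) - 1| <= d1 -> d1 <= 1 ->
  sqmod (cexpectation P Y) <= d2 ->
  `|u| <= (4 * K ^+ 2)^-1 ->
  (\int[P]_w (expR (2 * Re ((Y w)^* * l) + u * sqmod (Y w)))%:E <=
   (expR (u + 18 * K ^+ 2 * u ^+ 2 + 18 * K ^+ 2 * sqmod l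
          + (d1 + d2 / 2)))%:E)%E.
Proof.
move=> [mx my] K1 YK md1 d11 mud2 uK.
have K2 : 1 <= K ^+ 2 by exact: exprn_ege1.
have [uK4 u4] : `|u| * K ^+ 2 <= 1 / 4 /\ `|u| <= 1 / 4.
  have uK4 : `|u| * K ^+ 2 <= 1 / 4.
    rewrite -ler_pdivlMr; last lra.
    by rewrite (le_trans uK)// invfM div1r.
  by split => //; have := normr_ge0 u; nra.
have d10 : 0 <= d1 by exact: le_trans md1.
set L := sqmod l; have L0 : 0 <= L by exact: sqmod_ge0.
set m := \int[P]_w sqmod (Y w) in md1 *.
(* exp (2 Pp) and exp (2 Qq) will bound the expectations of the squared
   exponentials of the quadratic and of the linear term. *)
pose Pp := u + 8 * K ^+ 2 * u ^+ 2 + d1.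
pose Qq := 18 * K ^+ 2 * L + d2 / 2.
pose W := expR (Pp + Qq) / 2.
pose e1 := expR (- (2 * Pp)); pose e2 := expR (- (2 * Qq)).
pose G := expR (32 * K ^+ 2 * L).
have W0 : 0 < W by rewrite divr_gt0// expR_gt0.
have e10 : 0 < e1 by exact: expR_gt0.
have e20 : 0 < e2 by exact: expR_gt0.
apply: (le_trans (@integral_le_affine _ _ _ P
  (fun w => expR (2 * Re ((Y w)^* * l) + u * sqmod (Y w)))
  (fun w => sqmod (Y w)) (fun w => Re (Y w)) (fun w => Im (Y w))
  (W * (e1 + e2 * G)) (W * (e1 * (2 * u + 8 * K ^+ 2 * u ^+ 2)))
  (W * (e2 * (4 * Re l))) (W * (e2 * (4 * Im l))) (1 + K ^+ 2) _ _ mx my _ _ _ _)).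
- apply: measurableT_comp => //; apply: measurable_funD.
    apply: measurable_funM => //.
    by case: (cmeasurableM (cmeasurableJ (conj mx my)) (cmeasurable_cst l)).
  by apply: measurable_funM => //; exact: measurable_sqmod.
- exact: measurable_sqmod.
- by move=> w; rewrite ger0_norm ?sqmod_ge0//; have := YK w; lra.
- by move=> w; case: (abs_ReIm_le (YK w)).
- by move=> w; case: (abs_ReIm_le (YK w)).
- move=> w; rewrite expR_ge0/=.
  set s := sqmod (Y w); have s0 : 0 <= s by exact: sqmod_ge0.
  have sK : s <= K ^+ 2 := YK w.
  set q := 2 * Re _; have qE : q = 2 * (Re (Y w) * Re l + Im (Y w) * Im l).
    by rewrite /q; case: (Y w) (l) => [a b] [c e] /=; ring.
  have q2 : q ^+ 2 <= 4 * K ^+ 2 * L.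
    have : q ^+ 2 <= 4 * (s * L).
      rewrite qE /s /L /sqmod -subr_ge0.
      rewrite (_ : _ - _ = 4 * (Re (Y w) * Im l - Im (Y w) * Re l) ^+ 2);
        last by ring.
      by rewrite mulr_ge0// sqr_ge0.
    have : s * L <= K ^+ 2 * L by apply: ler_wpM2r.
    lra.
  rewrite addrC; apply: (le_trans (expRD_le_mean _ _ Pp Qq)).
  rewrite -/W.
  have -> : expR (2 * (u * s) - 2 * Pp) = e1 * expR (2 * (u * s)).
    by rewrite /e1 -expRD; congr expR; ring.
  have -> : expR (2 * q - 2 * Qq) = e2 * expR (2 * q).
    by rewrite /e2 -expRD; congr expR; ring.
  have H1 : expR (2 * (u * s)) <= 1 + (2 * u + 8 * K ^+ 2 * u ^+ 2) * s.
    have us : u * s <= 1 / 4.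
      apply: le_trans uK4; apply: (le_trans (ler_norm _)).
      by rewrite normrM (ger0_norm s0) ler_wpM2l.
    apply: (le_trans (expR_le_quadratic _)); first lra.
    have : (u ^+ 2 * s) * s <= (u ^+ 2 * s) * K ^+ 2.
      by rewrite ler_wpM2l// mulr_ge0// sqr_ge0.
    by rewrite !expr2; lra.
  have H2 : expR (2 * q) <= 2 * q + G.
    apply: (le_trans (expR_le_id_gauss _)); rewrite lerD2l ler_expR.
    by rewrite exprMn; lra.
  rewrite [leRHS](_ : _ = W * (e1 * (1 + (2 * u + 8 * K ^+ 2 * u ^+ 2) * s)
                            + e2 * (2 * q + G))); last by rewrite qE; ring.
  by rewrite ler_pM2l// lerD// ler_pM2l.
rewrite lee_fin -/m.
set mr := \int[P]_w Re (Y w); set mi := \int[P]_w Im (Y w).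
have {}mud2 : mr ^+ 2 + mi ^+ 2 <= d2.
  move: mud2; rewrite /cexpectation /sqmod /= !expectation.unlock; exact.
have m2 : m <= 2 by move: md1; rewrite ler_norml; lra.
have h1 : e1 * (1 + (2 * u + 8 * K ^+ 2 * u ^+ 2) * m) <= 1.
  rewrite -[leRHS](expRxMexpNx_1 (2 * Pp)) mulrC ler_pM2r//.
  apply: le_trans (expR_ge1Dx _); rewrite lerD2l /Pp.
  have : 8 * K ^+ 2 * u ^+ 2 * m <= 8 * K ^+ 2 * u ^+ 2 * 2.
    by rewrite ler_wpM2l// mulr_ge0 ?sqr_ge0//; lra.
  have : u * (m - 1) <= 1 / 4 * d1.
    apply: (le_trans (ler_norm _)); rewrite normrM.
    by apply: ler_pM.
  lra.
have h2 : e2 * (G + 4 * (Re l * mr + Im l * mi)) <= 1.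
  rewrite -[leRHS](expRxMexpNx_1 (2 * Qq)) mulrC ler_pM2r//.
  have KL0 : 0 <= K ^+ 2 * L by apply: mulr_ge0 => //; lra.
  have z0 : 0 <= 4 * K ^+ 2 * L + d2.
    by have := sqr_ge0 mr; have := sqr_ge0 mi; lra.
  have -> : 2 * Qq = 32 * K ^+ 2 * L + (4 * K ^+ 2 * L + d2).
    by rewrite /Qq; field.
  rewrite expRD -/G.
  have G1 : 1 <= G by have := expR_ge1Dx (32 * K ^+ 2 * L); rewrite -/G; lra.
  have := expR_ge1Dx (4 * K ^+ 2 * L + d2).
  have : 4 * (Re l * mr + Im l * mi) <= 4 * K ^+ 2 * L + d2.
    have : L <= K ^+ 2 * L by rewrite ler_peMl.
    rewrite /L /sqmod; have := sqr_ge0 (2 * Re l - mr).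
    have := sqr_ge0 (2 * Im l - mi).
    by rewrite !sqrrB; lra.
  by nra.
rewrite [leLHS](_ : _ = W * (e1 * (1 + (2 * u + 8 * K ^+ 2 * u ^+ 2) * m) +
  e2 * (G + 4 * (Re l * mr + Im l * mi)))); last by ring.
apply: (@le_trans _ _ (expR (Pp + Qq))).
  by rewrite /W; have := expR_gt0 (Pp + Qq); nra.
rewrite ler_expR /Pp /Qq.
have : 0 <= K ^+ 2 * u ^+ 2 by rewrite mulr_ge0// sqr_ge0.
by lra.
Qed.

End scalar_mgf.

(** * Integrating out one independent coordinate *)

Section independence.
Context {d : measure_display} {T : measurableType d} {R : realType}.
Variable P : probability T R.
Local Open Scope ereal_scope.

(** Independence says that the law of (U, V) is the product of the laws, because
    the two agree on rectangles; what remains is Tonelli's theorem. *)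
Lemma integral_indep_pair d1 d2 (T1 : measurableType d1)
    (T2 : measurableType d2) (U : {mfun T >-> T1}) (V : {mfun T >-> T2})
    (f : T1 * T2 -> \bar R) :
  (forall A B, measurable A -> measurable B ->
    P (U @^-1` A `&` V @^-1` B) = P (U @^-1` A) * P (V @^-1` B)) ->
  measurable_fun setT f -> (forall z, 0 <= f z) ->
  \int[P]_w f (U w, V w) = \int[P]_w \int[P]_w' f (U w, V w').
Proof.
move=> UV mf f0.
have mUV : measurable_fun setT (fun w => (U w, V w)).
  by apply: measurable_fun_pair; exact: measurable_funPT.
pose mW := isMeasurableFun.Build _ _ _ _ _ mUV.
pose W : {mfun T >-> (T1 * T2)%type} := HB.pack (fun w => (U w, V w)) mW.
have mF := @measurable_fun_fubini_tonelli_F _ _ _ _ _ (distribution P V) f mf f0.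
rewrite -[LHS](@ge0_integral_distribution _ _ _ _ _ P W f mf f0).
rewrite (@eq_measure_integral _ _ _ _ (distribution P U \x distribution P V)%E);
  last first.
  move=> A mA _; apply/esym; apply: product_measure_unique => //.
rewrite fubini_tonelli1// ge0_integral_distribution//; last first.
  by move=> x; exact: integral_ge0.
apply: eq_integral => w _ /=; rewrite /fubini_F ge0_integral_distribution//.
exact: measurableT_comp mf (pair1_measurable _).
Qed.

Variables (n : nat) (X : 'I_n -> {RV P >-> R[i]}).

(** Cylinder events that depend on the first k coordinates only; they form a
    pi-system. *)
Definition past_events (k : nat) : set (set T) :=
  [set \bigcap_(i in [set i : 'I_n | (i < k)%N]) (X i @^-1` B i) |
    B in [set B : 'I_n -> set R[i] | forall i, measurable (B i)]].

Lemma past_eventsI k : setI_closed (past_events k).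
Proof.
move=> _ _ [B mB <-] [D mD <-]; exists (fun i => B i `&` D i).
  by move=> i; apply: measurableI.
by rewrite -bigcapI; apply: eq_bigcapr => i _; rewrite preimage_setI.
Qed.

Lemma past_eventsT k : past_events k setT.
Proof.
exists (fun=> setT) => //.
by apply/seteqP; split.
Qed.

Lemma measurable_past_events k : past_events k `<=` measurable.
Proof.
move=> _ [B mB <-]; apply: fin_bigcap_measurable => // i _.
exact: measurable_funPTI.
Qed.

(** The sample space with the sigma-algebra generated by the first k
    coordinates.  With the identity as the map to this space, the joint law of
    the past and the next coordinate needs no space of tuples. *)
Definition past_space (k : nat) := g_sigma_algebraType (past_events k).

Lemma measurable_past k (A : set (past_space k)) :
  measurable A -> measurable (A : set T).
Proof.
apply: smallest_sub; first exact: sigma_algebra_measurable.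
exact: measurable_past_events.
Qed.

Lemma measurable_fun_past k (i : 'I_n) : (i < k)%N ->
  measurable_fun setT (X i : past_space k -> R[i]).
Proof.
move=> ik _ B mB; rewrite setTI; apply: sub_sigma_algebra.
exists (fun j => if j == i then B else setT).
  by move=> j; case: ifPn.
apply/seteqP; split => [w /(_ i ik)/=|w /= Bw j _ /=]; first by rewrite eqxx.
by case: eqVneq => [->|].
Qed.

(** Both sides are finite measures in A, and independence of the coordinates
    makes them agree on the pi-system that generates the past. *)
Lemma indep_past (k : 'I_n) (A : set T) (B : set R[i]) : independent_RVs X ->
  <<s past_events k >> A -> measurable B ->
  P (A `&` X k @^-1` B) = P A * P (X k @^-1` B).
Proof.
move=> indX sA mB.
have mXB : measurable (X k @^-1` B) by exact: measurable_funPTI.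
have XBfin : P (X k @^-1` B) \is a fin_num by exact: fin_num_measure.
have XB0 : (0 <= fine (P (X k @^-1` B)))%R by exact: fine_ge0.
pose r := NngNum XB0; have rE : r%:num%:E = P (X k @^-1` B) by exact: fineK.
rewrite muleC -[in RHS]rE.
rewrite -/(mrestr P mXB A) -[RHS]/(mscale r P A).
apply: (@g_sigma_algebra_measure_unique _ _ _ (past_events k) _ (fun=> setT))
  => //.
- exact: measurable_past_events.
- by move=> _; exact: past_eventsT.
- by rewrite bigcup_const.
- exact: past_eventsI.
- move=> _ [D mD <-]; rewrite /mrestr -[RHS]/(r%:num%:E * P _) rE.
  (* The cylinder together with the event on coordinate k is a cylinder over
     one coordinate more. *)
  pose J := [set i : 'I_n | (i < k)%N]%SET.
  pose D' i := if i == k then B else D i.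
  have mD' i : measurable (D' i) by rewrite /D'; case: ifP.
  have kJ : k \notin J by rewrite inE ltnn.
  have := indX (k |: J)%SET D' mD'; rewrite big_setU1//= {2}/D' eqxx.
  have -> : (\prod_(i in J) P (X i @^-1` D' i) =
             P (\bigcap_(i in [set i : 'I_n | (i < k)%N]) (X i @^-1` D i)))%E.
    rewrite (eq_bigr (fun i => P (X i @^-1` D i))) => [|i iJ]; last first.
      by rewrite /D'; case: eqVneq iJ => [->|//]; rewrite (negbTE kJ).
    rewrite -indX//; congr (P _).
    by apply/seteqP; split=> w wD i iJ; apply: wD; move: iJ; rewrite /= inE.
  move=> <-; congr (P _); apply/seteqP; split => [w [wD wB] i /=|w wD].
    rewrite !inE /D'; case: eqVneq => [->//|_ /= ik]; exact: wD.
  split=> [i /= ik|].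
    have := wD i; rewrite /= !inE ik orbT /D' => /(_ isT).
    by case: eqVneq ik => [->|//]; rewrite ltnn.
  by have := wD k; rewrite /= !inE eqxx /D' eqxx => /(_ isT).
- move=> _; apply: (@le_lt_trans _ _ 1); last exact: ltry.
  exact: probability_le1 (measurableI _ _ measurableT mXB).
Qed.

Lemma integral_indep_past (k : 'I_n) (f : past_space k * R[i] -> \bar R) :
  independent_RVs X ->
  measurable_fun setT f -> (forall z, 0 <= f z) ->
  \int[P]_w f (w, X k w) = \int[P]_w \int[P]_w' f (w, X k w').
Proof.
move=> indX mf f0.
have mid : measurable_fun setT (id : T -> past_space k).
  by move=> _ A mA; rewrite setTI; exact: (measurable_past mA).
pose mW := isMeasurableFun.Build _ _ _ _ _ mid.
pose W : {mfun T >-> past_space k} := HB.pack (id : T -> past_space k) mW.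
apply: (@integral_indep_pair _ _ _ _ W (X k)) => // A B mA mB.
exact: indep_past.
Qed.

End independence.

(** * Exponential moment of a Hermitian form *)

Section quadratic_mgf.
Context {d : measure_display} {T : measurableType d} {R : realType}.
Variable P : probability T R.
Variables (n : nat) (X : 'I_n -> {RV P >-> R[i]}) (tau : R[i] -> R[i]).
Variables (K d1 d2 : R).
Hypotheses (indX : independent_RVs X) (mtau : cmeasurable_fun tau).
Hypotheses (K1 : 1 <= K) (tauK : forall z, sqmod (tau z) <= K ^+ 2).
Hypothesis (d11 : d1 <= 1).
Hypothesis var_tau :
  forall i, `|\int[P]_w sqmod (tau (X i w)) - 1| <= d1.
Hypothesis mean_tau :
  forall i, sqmod (cexpectation P (fun w => tau (X i w))) <= d2.

Definition coords (w : T) (j : nat) : R[i] :=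
  if insub j is Some i then tau (X i w) else 0.

Variables g t : R.
Hypotheses (gE : g = 18 * K ^+ 2) (gt : 4 * g * t = 1).

Let coords_ord w (i : 'I_n) : coords w i = tau (X i w).
Proof. by rewrite /coords valK. Qed.

Lemma cmeasurable_coords k j : (j < k)%N ->
  cmeasurable_fun (fun w : past_space X k => coords w j).
Proof.
move=> jk; rewrite /coords; case: insubP => [i _ ij|_]; last first.
  exact: cmeasurable_cst.
have ik : (i < k)%N by rewrite ij.
exact: (cmeasurable_comp (@measurable_fun_past _ _ _ P _ X k i ik) mtau).
Qed.

Lemma cmeasurable_rowdot k B :
  cmeasurable_fun (fun w : past_space X k => rowdot k B (coords w)).
Proof.
apply: cmeasurable_sum => i _.
by apply: cmeasurableM; [exact: cmeasurable_cst|exact: cmeasurable_coords].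
Qed.

Lemma measurable_qform k B :
  measurable_fun setT (fun w : past_space X k => qform k B (coords w)).
Proof.
suff [//] : cmeasurable_fun (fun w : past_space X k =>
    \sum_(i < k) \sum_(j < k) (coords w i)^* * B i j * coords w j).
apply: cmeasurable_sum => i _; apply: cmeasurable_sum => j _.
apply: cmeasurableM; last exact: cmeasurable_coords.
apply: cmeasurableM; last exact: cmeasurable_cst.
exact: cmeasurableJ (cmeasurable_coords _).
Qed.

Lemma measurable_past_fun k (f : past_space X k -> R) :
  measurable_fun setT f -> measurable_fun setT (f : T -> R).
Proof.
move=> mf _ B mB; rewrite setTI; apply: (@measurable_past _ _ _ _ _ X k).
by rewrite -[X in measurable X]setTI; exact: mf.
Qed.

Lemma measurable_to_past k (f : T * T -> T) :
  measurable_fun setT f -> measurable_fun setT (f : _ -> past_space X k).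
Proof.
move=> mf _ B mB; apply: (mf measurableT).
exact: (@measurable_past _ _ _ _ _ X k).
Qed.

Let K2 : 1 <= K ^+ 2.
Proof. exact: exprn_ege1. Qed.

Let g_gt0 : 0 < g.
Proof. by rewrite gE; have := K2; lra. Qed.

Let tE : t = (4 * g)^-1.
Proof.
have g4 : 4 * g != 0 by rewrite lt0r_neq0// mulr_gt0.
by apply: (mulfI g4); rewrite gt divff.
Qed.

Let t_gt0 : 0 < t.
Proof. by rewrite tE invr_gt0 mulr_gt0. Qed.

(** The form in k+1 variables with its last variable split off, as a function of
    the past and of the value of coordinate k. *)
Definition conditioned k B (z : past_space X k * R[i]) : R :=
  qform k B (coords z.1) + (2 * Re ((tau z.2)^* * rowdot k B (coords z.1))
    + Re (B k k) * sqmod (tau z.2)).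

Lemma measurable_conditioned k B : measurable_fun setT (@conditioned k B).
Proof.
have mtau2 : cmeasurable_fun (fun z : past_space X k * R[i] => tau z.2).
  exact: (cmeasurable_comp measurable_snd mtau).
apply: measurable_funD.
  exact: (measurableT_comp (@measurable_qform k B) measurable_fst).
apply: measurable_funD; last first.
  by apply: measurable_funM => //; exact: measurable_sqmod.
apply: measurable_funM => //.
have [] // := cmeasurableM (cmeasurableJ mtau2)
  (cmeasurable_comp measurable_fst (@cmeasurable_rowdot k B)).
Qed.

(** Induction on k.  Conditionally on the past, [mgf_scalar] replaces the last
    coordinate by the constant factor exp (u + g u^2 + d1 + d2 / 2) and turns
    the form into [elim_last], which satisfies the same spectral bound;
    [potential_elim] then closes the induction. *)
Lemma mgf_qform k B : (k <= n)%N -> hermitian B -> form_bounded t k B ->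
  (\int[P]_w (expR (qform k B (coords w)))%:E <=
   (expR (rtrace k B + g * frob2 k B + k%:R * (d1 + d2 / 2)))%:E)%E.
Proof.
elim: k B => [|k IH] B kn hB tB.
  under eq_integral do rewrite /qform big_ord0 /= expR0.
  rewrite integral_cst// [X in (_ * X)%E](probability_setT P) mule1 lee_fin.
  by rewrite /rtrace /frob2 !big_ord0 mulr0 mul0r !addr0 expR0.
pose i := Ordinal kn; set u := Re (B k k).
pose F (z : past_space X k * R[i]) : \bar R := (expR (conditioned B z))%:E.
have mF : measurable_fun setT F.
  apply/measurable_EFinP; apply: measurableT_comp => //.
  exact: measurable_conditioned.
have F0 z : (0 <= F z)%E by rewrite lee_fin expR_ge0.
have -> : (\int[P]_w (expR (qform k.+1 B (coords w)))%:E =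
           \int[P]_w F (w, X i w))%E.
  apply: eq_integral => w _; rewrite /F /conditioned /= qformS//.
  by rewrite -[k in coords w k]/(val i) coords_ord addrA.
rewrite (@integral_indep_past _ _ _ P n X i)//.
have ut : `|u| <= t := form_bounded_diag hB tB.
have mtauX : cmeasurable_fun (fun w => tau (X i w)).
  exact: (cmeasurable_comp (@measurable_funPT _ _ _ _ (X i)) mtau).
pose c := u + g * u ^+ 2 + (d1 + d2 / 2).
pose B' := elim_last g k B.
have mB' : measurable_fun setT (fun w : T => expR (qform k B' (coords w))).
  apply: measurableT_comp => //.
  exact: (@measurable_past_fun k _ (@measurable_qform k B')).
apply: (@le_trans _ _
    (\int[P]_w ((expR c)%:E * (expR (qform k B' (coords w)))%:E))%E).
  apply: ge0_le_integral => //.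
  - by move=> w _; exact: integral_ge0.
  (* Measurability of the inner integral comes from Tonelli's theorem on T * T,
     where both arguments keep the full sigma-algebra. *)
  - pose F2 (z : T * T) := F (z.1, X i z.2).
    have mF2 : measurable_fun setT F2.
      apply: (measurableT_comp mF); apply: measurable_fun_pair.
        exact: (@measurable_to_past k _ measurable_fst).
      exact: measurableT_comp measurable_snd.
    by apply: (@measurable_fun_fubini_tonelli_F _ _ _ _ _ P F2 mF2) => z;
      exact: F0.
  - by apply: emeasurable_funM => //; exact/measurable_EFinP.
  - move=> w _; rewrite -EFinM -expRD /F /conditioned /=.
    under eq_integral => w' _ do rewrite expRD EFinM.
    rewrite ge0_integralZl//; last first.
      apply/measurable_EFinP; apply: measurableT_comp => //.
      apply: measurable_funD; last first.
        by apply: measurable_funM => //; exact: measurable_sqmod.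
      apply: measurable_funM => //.
      by case: (cmeasurableM (cmeasurableJ mtauX)
        (cmeasurable_cst (rowdot k B (coords w)))).
    have -> : c + qform k B' (coords w) = qform k B (coords w) +
        (c + g * sqmod (rowdot k B (coords w))) by rewrite qform_elim//; ring.
    rewrite expRD EFinM lee_pmul2l ?lte_fin ?expR_gt0//.
    apply: (@le_trans _ _ (expR (u + 18 * K ^+ 2 * u ^+ 2 +
      18 * K ^+ 2 * sqmod (rowdot k B (coords w)) + (d1 + d2 / 2)))%:E); last first.
      by rewrite lee_fin ler_expR /c gE; lra.
    apply: mgf_scalar => //.
    + apply: (le_trans ut); rewrite tE gE lef_pV2 ?posrE; have := K2; lra.
rewrite ge0_integralZl//; last exact/measurable_EFinP.
apply: (@le_trans _ _ ((expR c)%:E *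
    (expR (rtrace k B' + g * frob2 k B' + k%:R * (d1 + d2 / 2)))%:E)%E).
  rewrite lee_pmul2l ?lte_fin ?expR_gt0//; apply: IH.
  - exact: ltnW.
  - exact: hermitian_elim_last.
  - apply: form_bounded_elim => //; [exact: ltW|].
    by have := gt; lra.
rewrite -EFinM -expRD lee_fin ler_expR /c.
have := potential_elim hB tB g_gt0 _ t_gt0; rewrite -/u -/B' => H.
have {}H := H ltac:(by rewrite gt).
by rewrite -addn1 natrD; lra.
Qed.

End quadratic_mgf.

(** * Frobenius and spectral norms *)

Section matrix_forms.
Variable R : realType.
Implicit Types n : nat.

Lemma cabs_sqr (z : R[i]) : cabs z ^+ 2 = sqmod z.
Proof. by case: z => a b; rewrite sqr_sqrtr// addr_ge0// sqr_ge0. Qed.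

Lemma cabs_ge0 (z : R[i]) : 0 <= cabs z.
Proof. by case: z => a b; exact: sqrtr_ge0. Qed.

Lemma cabs_sum I (r : seq I) (Q : pred I) (F : I -> R[i]) :
  cabs (\sum_(i <- r | Q i) F i) <= \sum_(i <- r | Q i) cabs (F i).
Proof.
elim/big_rec2: _ => [|i x y _ xy]; first by rewrite ComplexField.Normc.normc0.
by apply: (le_trans (le_normcD _ _)); rewrite lerD2l.
Qed.

Lemma frobenius_norm_ge0 m n (A : 'M[R[i]]_(m, n)) : 0 <= frobenius_norm A.
Proof. exact: sqrtr_ge0. Qed.

Lemma frobenius_norm_sqr m n (A : 'M[R[i]]_(m, n)) :
  frobenius_norm A ^+ 2 = \sum_i \sum_j sqmod (A i j).
Proof.
rewrite sqr_sqrtr; last first.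
  by apply: sumr_ge0 => i _; apply: sumr_ge0 => j _; exact: sqr_ge0.
by apply: eq_bigr => i _; apply: eq_bigr => j _; exact: cabs_sqr.
Qed.

Lemma col_norm_sqr n (v : 'cV[R[i]]_n) :
  frobenius_norm v ^+ 2 = \sum_i sqmod (v i 0).
Proof. by rewrite frobenius_norm_sqr; apply: eq_bigr => i _; rewrite big_ord1. Qed.

Lemma frobenius_normZ m n (c : R) (A : 'M[R[i]]_(m, n)) : 0 <= c ->
  frobenius_norm (c%:C%C *: A) = c * frobenius_norm A.
Proof.
move=> c0; apply/eqP; rewrite -(@eqrXn2 _ 2)//; last 2 first.
- exact: frobenius_norm_ge0.
- by rewrite mulr_ge0// frobenius_norm_ge0.
rewrite exprMn !frobenius_norm_sqr mulr_sumr; apply/eqP; apply: eq_bigr => i _.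
by rewrite mulr_sumr; apply: eq_bigr => j _; rewrite mxE sqmodM sqmod_real.
Qed.

Section spectral.
Variables (n : nat) (A : 'M[R[i]]_n).

Let unit_images := [set frobenius_norm (A *m v) | v in
  [set v : 'cV[R[i]]_n | frobenius_norm v <= 1]].

(** Entries of a vector of norm at most 1 have modulus at most 1, which makes
    the row sums of moduli a bound. *)
Let unit_images_ub : has_ubound unit_images.
Proof.
exists (Num.sqrt (\sum_i (\sum_j cabs (A i j)) ^+ 2)) => _ [v v1 <-].
have cabs_v j : cabs (v j 0) <= 1.
  rewrite -(@ler_pXn2r _ 2)// ?nnegrE ?cabs_ge0// expr1n cabs_sqr.
  apply: (@le_trans _ _ (frobenius_norm v ^+ 2)); last first.
    by rewrite exprn_ile1// frobenius_norm_ge0.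
  rewrite col_norm_sqr (bigD1 j)//= lerDl.
  by apply: sumr_ge0 => i _; exact: sqmod_ge0.
rewrite ler_wsqrtr//; apply: ler_sum => i _; rewrite big_ord1.
rewrite ler_pXn2r// ?nnegrE ?cabs_ge0//; last first.
  by apply: sumr_ge0 => j _; exact: cabs_ge0.
rewrite mxE; apply: (le_trans (cabs_sum _ _ _)); apply: ler_sum => j _.
rewrite ComplexField.Normc.normcM -[leRHS]mulr1.
by rewrite ler_wpM2l// cabs_ge0.
Qed.

Lemma spectral_norm_ge0 : 0 <= spectral_norm A.
Proof.
apply: (@le_trans _ _ (frobenius_norm (A *m 0))); first exact: frobenius_norm_ge0.
apply: (ub_le_sup unit_images_ub); exists 0 => //=.
rewrite -(@scale0r _ _ (0 : 'cV[R[i]]_n)) -(rmorph0 (@real_complex_def R _)).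
by rewrite frobenius_normZ ?mul0r.
Qed.

Lemma norm_mulmx_le (v : 'cV[R[i]]_n) :
  frobenius_norm (A *m v) <= spectral_norm A * frobenius_norm v.
Proof.
have [v0|v0] := eqVneq (frobenius_norm v) 0.
  have vE : v = 0.
    apply/matrixP => i j; rewrite mxE ord1.
    have := col_norm_sqr v; rewrite v0 expr0n /= => /esym/eqP.
    rewrite psumr_eq0 => [/allP/(_ i (mem_index_enum _))/eqP|k _];
      last exact: sqmod_ge0.
    by rewrite -cabs_sqr => /eqP; rewrite sqrf_eq0 => /eqP/ComplexField.Normc.eq0_normc.
  rewrite v0 mulr0 vE mulmx0 -vE v0//.
have vgt0 : 0 < frobenius_norm v by rewrite lt0r v0 frobenius_norm_ge0.
rewrite -ler_pdivrMr// mulrC -frobenius_normZ ?invr_ge0 ?frobenius_norm_ge0// scalemxAr.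
apply: (ub_le_sup unit_images_ub); eexists; last reflexivity.
by rewrite /= frobenius_normZ ?invr_ge0 ?frobenius_norm_ge0// mulVf.
Qed.

Lemma quad_formE (v : 'cV[R[i]]_n) :
  quad_form A v = \sum_i (v i 0)^* * (A *m v) i 0.
Proof.
by rewrite /quad_form -mulmxA mxE; apply: eq_bigr => i _; rewrite !mxE.
Qed.

(** Instead of Cauchy-Schwarz, each term Re (conj y z) is bounded by
    (s |y|^2 + |z|^2 / s) / 2, which involves squared moduli only; s is then
    the spectral norm S.  If S = 0 any s is allowed, and a value proportional
    to the left-hand side x gives x <= x / 2. *)
Lemma Re_quad_form_le (o : R[i]) (v : 'cV[R[i]]_n) : sqmod o = 1 ->
  `|Re (o * quad_form A v)| <= spectral_norm A * frobenius_norm v ^+ 2.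
Proof.
move=> o1; set S := spectral_norm A; have S0 : 0 <= S := spectral_norm_ge0.
set N := frobenius_norm v ^+ 2; have N0 : 0 <= N by exact: sqr_ge0.
set x := `|_|; have x0 : 0 <= x by exact: normr_ge0.
have AvN : frobenius_norm (A *m v) ^+ 2 <= S ^+ 2 * N.
  rewrite -exprMn; apply: lerXn2r; rewrite ?nnegrE ?mulr_ge0 ?frobenius_norm_ge0//.
  exact: norm_mulmx_le.
have young s : 0 < s -> x <= (s * N + (S ^+ 2 * N) / s) / 2.
  move=> s0; apply: (@le_trans _ _ ((s * N + frobenius_norm (A *m v) ^+ 2 / s) / 2)).
    rewrite /x quad_formE mulr_sumr Re_sum; apply: (le_trans (ler_norm_sum _ _ _)).
    rewrite /N !col_norm_sqr mulr_sumr !mulr_suml -big_split /= mulr_suml.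
    apply: ler_sum => i _; set y := v i 0; set z := (A *m v) i 0.
    have -> : sqmod z = sqmod (o * z) by rewrite sqmodM o1 mul1r.
    rewrite mulrCA; case: (o * z) (y) => [a b] [c e]; rewrite /sqmod /= mulNr opprK.
    have -> : (s * (c ^+ 2 + e ^+ 2) + (a ^+ 2 + b ^+ 2) / s) / 2 =
      ((s * c) ^+ 2 + (s * e) ^+ 2 + a ^+ 2 + b ^+ 2) / (2 * s).
      by field; rewrite gt_eqF.
    rewrite ler_pdivlMr; last lra.
    rewrite -[2 * s]gtr0_norm; last lra.
    rewrite -normrM ler_norml.
    have := sqr_ge0 (s * c - a); have := sqr_ge0 (s * c + a).
    have := sqr_ge0 (s * e - b); have := sqr_ge0 (s * e + b).
    by rewrite !sqrrB !sqrrD; lra.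
  by rewrite ler_pM2r// lerD2l ler_pM2r ?invr_gt0.
have [S00|Sn0] := eqVneq S 0; last first.
  have Sgt0 : 0 < S by rewrite lt0r Sn0.
  apply: (le_trans (young S Sgt0)).
  by rewrite (_ : _ / 2 = S * N)//; field.
rewrite S00 mul0r leNgt; apply/negP => xgt0.
have := young (x / (N + 1)); rewrite S00 expr0n /= mul0r mul0r addr0.
have N1 : 0 < N + 1 by lra.
move=> /(_ (divr_gt0 xgt0 N1)) h.
have : x / (N + 1) * N <= x by rewrite mulrAC ler_pdivrMr//; nra.
lra.
Qed.

End spectral.
End matrix_forms.

(** * Moments of truncated variables *)

Section truncated_moments.
Context {d : measure_display} {T : measurableType d} {R : realType}.
Variable P : probability T R.

(** As a function of the value alone, so that truncated coordinates inherit
    independence; [truncation K Y] is definitionally [truncate K] after Y. *)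
Definition truncate (K : R) (z : R[i]) : R[i] :=
  z * (\1_[set z | cabs z <= K] z)%:C%C.

Lemma truncate_id (K : R) z : cabs z <= K -> truncate K z = z.
Proof. by move=> zK; rewrite /truncate indicE mem_set// mulr1. Qed.

Lemma sqmod_truncate (K : R) z : 0 <= K -> sqmod (truncate K z) <= K ^+ 2.
Proof.
move=> K0; rewrite /truncate sqmodM sqmod_real indicE.
have [|] := boolP (z \in _); last by rewrite expr0n mulr0 sqr_ge0.
rewrite inE /= => zK; rewrite expr1n mulr1 -cabs_sqr.
by apply: lerXn2r; rewrite ?nnegrE ?cabs_ge0.
Qed.

Lemma measurable_cabs_le (K : R) : measurable [set z : R[i] | cabs z <= K].
Proof.
have [K0|K0] := leP 0 K.
  have -> : [set z : R[i] | cabs z <= K] =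
      (fun z => sqmod z) @^-1` `]-oo, K ^+ 2].
    apply/seteqP; split => z /=; rewrite in_itv /= -cabs_sqr.
      by move=> zK; apply: lerXn2r; rewrite ?nnegrE ?cabs_ge0.
    by rewrite ler_pXn2r ?nnegrE ?cabs_ge0.
  rewrite -[X in measurable X]setTI.
  by apply: (measurable_sqmod (@cmeasurable_id R)).
rewrite (_ : mkset _ = set0)//; apply/seteqP; split => z //=.
by move=> zK; have := cabs_ge0 z; lra.
Qed.

Lemma cmeasurable_truncate (K : R) : cmeasurable_fun (truncate K).
Proof.
apply: cmeasurableM; first exact: cmeasurable_id.
split; last exact: measurable_cst.
exact: measurable_indic (measurable_cabs_le K).
Qed.

Lemma sqmodB (y z : R[i]) : sqmod (y - z) =
  sqmod y + - 2 * Re z * Re y + - 2 * Im z * Im y + sqmod z.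
Proof. by case: y z => [a b] [c e]; rewrite /sqmod /=; ring. Qed.

Lemma variance_sqmod (Y : T -> R[i]) (M : R) : cmeasurable_fun Y ->
  (forall w, sqmod (Y w) <= M) ->
  fine (cvariance P Y) =
  \int[P]_w sqmod (Y w) - sqmod (cexpectation P Y).
Proof.
move=> mY YM; have [mx my] := mY.
set mu := cexpectation P Y.
have muE : Re mu = \int[P]_w Re (Y w) /\ Im mu = \int[P]_w Im (Y w).
  by rewrite /mu /cexpectation /= !expectation.unlock.
have int (c : R) (f : T -> R) : measurable_fun setT f ->
    (forall w, `|f w| <= 1 + M) ->
    P.-integrable setT (EFin \o (fun w => c * f w)).
  move=> mf fM; apply: (@integrable_bounded _ _ _ _ _ (`|c| * (1 + M))).
    exact: measurable_funM.
  by move=> w; rewrite normrM ler_wpM2l.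
have ix (c : R) : P.-integrable setT (EFin \o (fun w => c * Re (Y w))).
  by apply: int => // w; case: (abs_ReIm_le (YM w)).
have iy (c : R) : P.-integrable setT (EFin \o (fun w => c * Im (Y w))).
  by apply: int => // w; case: (abs_ReIm_le (YM w)).
have isq : P.-integrable setT (EFin \o (fun w => sqmod (Y w))).
  apply: (@integrable_bounded _ _ _ _ _ M); first exact: measurable_sqmod.
  by move=> w; rewrite ger0_norm ?sqmod_ge0.
have ic : P.-integrable setT (EFin \o (fun _ : T => sqmod mu)).
  by apply: (@integrable_bounded _ _ _ _ _ `|sqmod mu|).
have i1 : P.-integrable setT
    (EFin \o (fun w => sqmod (Y w) + - 2 * Re mu * Re (Y w))).
  exact: integrableD isq (ix _).
have i2 : P.-integrable setT (EFin \o
    (fun w => sqmod (Y w) + - 2 * Re mu * Re (Y w) + - 2 * Im mu * Im (Y w))).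
  exact: integrableD i1 (iy _).
have x1 : P.-integrable setT (EFin \o (fun w => Re (Y w))).
  by have := ix 1; congr (P.-integrable _ _); apply/funext => w /=; rewrite mul1r.
have y1 : P.-integrable setT (EFin \o (fun w => Im (Y w))).
  by have := iy 1; congr (P.-integrable _ _); apply/funext => w /=; rewrite mul1r.
rewrite /cvariance expectation.unlock -/(Rintegral _ _ _) -/mu.
transitivity (\int[P]_w (sqmod (Y w) + - 2 * Re mu * Re (Y w) +
    - 2 * Im mu * Im (Y w) + sqmod mu)).
  congr fine; apply: eq_integral => w _ /=; congr EFin; rewrite cabs_sqr.
  exact: sqmodB.
rewrite RintegralD// RintegralD// RintegralD// !RintegralZl//.
have -> : \int[P]_w sqmod mu = sqmod mu.
  rewrite Rintegral_cst// -[RHS]mulr1; congr (_ * _).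
  exact: (congr1 fine (probability_setT P)).
rewrite -muE.1 -muE.2 (_ : sqmod mu = Re mu ^+ 2 + Im mu ^+ 2)//.
ring.
Qed.

End truncated_moments.

(** * Tail bound *)

Section tail_bound.
Variable R : realType.

Definition entry n (A : 'M[R[i]]_n) (i j : nat) : R[i] :=
  if (insub i, insub j) is (Some i', Some j') then A i' j' else 0.

Lemma entry_ord n (A : 'M[R[i]]_n) (i j : 'I_n) : entry A i j = A i j.
Proof. by rewrite /entry !valK. Qed.

(** The Hermitian part of lam o A.  For unit complex numbers o its form is
    lam Re (o v^H A v), and the four choices 1, -1, i, -i of o give both signs
    of the real and imaginary parts of the quadratic form of A. *)
Definition herm_part n (lam : R) (o : R[i]) (A : 'M[R[i]]_n) (i j : nat) : R[i] :=
  (lam / 2)%:C%C * (o * entry A i j + (o * entry A j i)^*).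

Section herm_part_theory.
Variables (n : nat) (A : 'M[R[i]]_n) (lam : R) (o : R[i]).
Hypothesis o1 : sqmod o = 1.

Lemma hermitian_herm_part : hermitian (herm_part lam o A).
Proof.
by move=> i j; rewrite /herm_part !(conjcM, conjcD, conjcR, conjcK) addrC.
Qed.

Lemma qform_herm_part (v : nat -> R[i]) :
  qform n (herm_part lam o A) v =
  lam * Re (o * quad_form A (\col_(i < n) v i)).
Proof.
pose s := \sum_(i < n) \sum_(j < n) (v i)^* * entry A i j * v j.
have sE : s = quad_form A (\col_i v i).
  rewrite quad_formE; apply: eq_bigr => i _; rewrite !mxE mulr_sumr.
  by apply: eq_bigr => j _; rewrite mxE entry_ord mulrA.
rewrite -sE /qform.
have -> : \sum_(i < n) \sum_(j < n) (v i)^* * herm_part lam o A i j * v j =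
    (lam / 2)%:C%C * (o * s + (o * s)^*).
  pose S (i j : 'I_n) := (v i)^* * entry A i j * v j.
  set c := (lam / 2)%:C%C.
  transitivity (\sum_i \sum_j (c * (o * S i j) + c * (o * S j i)^*)).
    apply: eq_bigr => i _; apply: eq_bigr => j _.
    by rewrite /herm_part /S -/c !(conjcM, conjcK); ring.
  under eq_bigr do rewrite big_split /=.
  rewrite big_split mulrDr /=; congr (_ + _).
    rewrite /s !mulr_sumr; apply: eq_bigr => i _.
    by rewrite !mulr_sumr.
  rewrite exchange_big conjcM conjc_sum !mulr_sumr; apply: eq_bigr => i _ /=.
  rewrite conjc_sum !mulr_sumr; apply: eq_bigr => j _.
  by rewrite conjcM.
by rewrite ReZ ReD ReJ; field.
Qed.

Lemma rtrace_herm_part : rtrace n (herm_part lam o A) = lam * Re (o * \tr A).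
Proof.
rewrite /mxtrace mulr_sumr Re_sum mulr_sumr; apply: eq_bigr => i _.
by rewrite /herm_part ReZ ReD ReJ !entry_ord; field.
Qed.

Lemma frob2_herm_part :
  frob2 n (herm_part lam o A) <= lam ^+ 2 * frobenius_norm A ^+ 2.
Proof.
rewrite frobenius_norm_sqr.
have -> : \sum_(i < n) \sum_(j < n) sqmod (A i j) =
  \sum_(i < n) \sum_(j < n) ((sqmod (A i j) + sqmod (A j i)) / 2).
  under [RHS]eq_bigr do rewrite -mulr_suml big_split /=.
  rewrite -mulr_suml big_split /= [X in (_ + X) / _]exchange_big /=; by field.
rewrite mulr_sumr; apply: ler_sum => i _.
rewrite mulr_sumr; apply: ler_sum => j _.
rewrite /herm_part !entry_ord sqmodM sqmod_real.
have oE z : sqmod z = sqmod (o * z) by rewrite sqmodM o1 mul1r.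
rewrite [in leRHS](oE (A i j)) [in leRHS](oE (A j i)).
case: (o * A i j) (o * A j i) => [a b] [c e]; rewrite /sqmod /=.
rewrite -subr_ge0.
rewrite (_ : _ - _ = ((lam * (a - c)) ^+ 2 + (lam * (b + e)) ^+ 2) / 4);
  last by field.
by rewrite divr_ge0// addr_ge0// sqr_ge0.
Qed.

Lemma form_bounded_herm_part t : 0 <= lam -> lam * spectral_norm A <= t ->
  form_bounded t n (herm_part lam o A).
Proof.
move=> lam0 At v; rewrite qform_herm_part normrM (ger0_norm lam0).
apply: (@le_trans _ _ (lam * (spectral_norm A * sqnorm n v))).
  rewrite ler_wpM2l//; apply: (le_trans (Re_quad_form_le _ _ o1)).
  rewrite col_norm_sqr /sqnorm.
  by under eq_bigr do rewrite mxE.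
by rewrite mulrA ler_wpM2r// sqnorm_ge0.
Qed.

End herm_part_theory.

Section chernoff.
Context {d : measure_display} {T : measurableType d}.
Variable P : probability T R.

Lemma measurable_quad_form n (A : 'M[R[i]]_n) (v : 'I_n -> T -> R[i]) :
  (forall i, cmeasurable_fun (v i)) ->
  cmeasurable_fun (fun w => quad_form A (\col_i v i w)).
Proof.
move=> mv.
rewrite (_ : (fun w => _) = (fun w => \sum_(i < n) \sum_(j < n)
    (v i w)^* * (A i j * v j w))).
  apply: cmeasurable_sum => i _; apply: cmeasurable_sum => j _.
  apply: cmeasurableM; first exact: cmeasurableJ.
  by apply: cmeasurableM => //; exact: cmeasurable_cst.
apply/funext => w; rewrite quad_formE; apply: eq_bigr => i _.
by rewrite !mxE mulr_sumr; apply: eq_bigr => j _; rewrite mxE.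
Qed.

Lemma exponential_markov (f : T -> R) (r lam : R) : measurable_fun setT f ->
  0 <= lam ->
  (P [set w | (r <= f w)%R] <= \int[P]_w (expR (lam * (f w - r)))%:E)%E.
Proof.
move=> mf lam0; have mE : measurable [set w | r <= f w].
  rewrite (_ : mkset _ = f @^-1` `[r, +oo[).
    by rewrite -[X in measurable X]setTI; exact: mf.
  by apply/seteqP; split => w /=; rewrite in_itv /= andbT.
have := @integral_indic _ _ _ P setT measurableT _ mE; rewrite setIT => <-.
apply: ge0_le_integral => //.
- exact/measurable_EFinP/measurable_indic.
- apply/measurable_EFinP; apply: measurableT_comp => //.
  by apply: measurable_funM => //; exact: measurable_funB.
- move=> w _; rewrite lee_fin indicE; case: (boolP (w \in _)) => [|_].
    rewrite inE /= => rf; have := expR_ge1Dx (lam * (f w - r)).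
    have : 0 <= lam * (f w - r) by rewrite mulr_ge0// subr_ge0.
    lra.
  exact: expR_ge0.
Qed.

Variables (n : nat) (X : 'I_n -> {RV P >-> R[i]}) (K : R).
Hypotheses (indX : independent_RVs X) (K1 : 1 < K).
Variables e2 e3 : R.
Hypotheses (eps2_le : eps2 P X K <= e2) (eps3_le : eps3 P X K <= e3).
Hypotheses (e2h : e2 <= 1 / 2) (e3h : e3 <= 1 / 2).

Let Y i w := truncate K (X i w).

Let mY i : cmeasurable_fun (Y i).
Proof.
exact: (cmeasurable_comp (@measurable_funPT _ _ _ _ (X i))
  (cmeasurable_truncate K)).
Qed.

(** The mean and variance of the truncated coordinates differ from 0 and 1 by
    controlled amounts, E |Y_i|^2 - 1 = (sigma_i^2 - 1) + |mu_i|^2, so the error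
    per coordinate is e3 + (3/2) e2^2, at most e2 + e3 because e2 <= 1/2. *)
Lemma truncated_chernoff (A : 'M[R[i]]_n) (o : R[i]) (lam r : R) :
  sqmod o = 1 -> 0 <= lam -> lam * spectral_norm A <= (72 * K ^+ 2)^-1 ->
  (P [set w | (r <= Re (o * (quad_form A (\col_i Y i w) - \tr A)))%R] <=
   (expR (18 * K ^+ 2 * (lam ^+ 2 * frobenius_norm A ^+ 2) - lam * r
          + n%:R * (e2 + e3)))%:E)%E.
Proof.
move=> o1 lam0 lamA.
have K2 : 1 <= K ^+ 2 by apply: exprn_ege1; exact: ltW.
pose f w := Re (o * (quad_form A (\col_i Y i w) - \tr A)).
have mf : measurable_fun setT f.
  suff [] : cmeasurable_fun (fun w => o * (quad_form A (\col_i Y i w) - \tr A)) by [].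
  apply: cmeasurableM; first exact: cmeasurable_cst.
  by apply: cmeasurableD; [exact: measurable_quad_form|exact: cmeasurable_cst].
apply: (le_trans (exponential_markov _ mf lam0)).
pose B := herm_part lam o A.
have e20 : 0 <= e2.
  apply: le_trans eps2_le; rewrite /eps2.
  by elim/big_rec: _ => // i x _ x0; rewrite le_max x0 orbT.
have mean_le i : sqmod (cexpectation P (Y i)) <= e2 ^+ 2.
  rewrite -cabs_sqr; apply: lerXn2r; rewrite ?nnegrE ?cabs_ge0//.
  apply: le_trans eps2_le.
  exact: (le_bigmax _ (fun i => cabs (cexpectation P (truncation K (X i))))).
have YK z : sqmod (truncate K z) <= K ^+ 2 by apply: sqmod_truncate; have := K1; lra.
have var_le i : `|\int[P]_w sqmod (Y i w) - 1| <= e3 + e2 ^+ 2.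
  have : `|fine (cvariance P (Y i)) - 1| <= e3.
    apply: le_trans eps3_le.
    exact: (le_bigmax _ (fun i => `|fine (cvariance P (truncation K (X i))) - 1|)).
  rewrite (variance_sqmod P (mY i) (fun w => YK (X i w))).
  have := mean_le i; have := sqmod_ge0 (cexpectation P (Y i)).
  by rewrite !ler_norml; lra.
have e22 : e2 ^+ 2 <= e2 * (1 / 2) by rewrite expr2 ler_wpM2l.
have d11 : e3 + e2 ^+ 2 <= 1 by have := e2h; have := e3h; lra.
have gt : 4 * (18 * K ^+ 2) * (72 * K ^+ 2)^-1 = 1.
  by field; rewrite lt0r_neq0//; have := K1; lra.
have := @mgf_qform _ _ _ P n X (truncate K) K (e3 + e2 ^+ 2) (e2 ^+ 2) indX
  (cmeasurable_truncate K) (ltW K1) YK d11 var_le mean_le (18 * K ^+ 2)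
  (72 * K ^+ 2)^-1 erefl gt n B (leqnn n) (hermitian_herm_part A lam o)
  (form_bounded_herm_part o1 lam0 lamA).
have qE w : lam * (f w - r) = - (lam * Re (o * \tr A) + lam * r)
    + qform n B (coords X (truncate K) w).
  rewrite qform_herm_part (_ : \col_i coords X (truncate K) w i = \col_i Y i w).
    by rewrite /f (mulrBr o) ReD ReN; ring.
  by apply/matrixP => i j; rewrite !mxE /coords valK.
move=> H.
rewrite (eq_integral (fun w =>
    (expR (- (lam * Re (o * \tr A) + lam * r)))%:E *
    (expR (qform n B (coords X (truncate K) w)))%:E)%E) => [|w _]; last first.
  by rewrite -EFinM -expRD -qE.
rewrite ge0_integralZl//; last first.
  apply/measurable_EFinP; apply: measurableT_comp => //.
  exact: (@measurable_past_fun _ _ _ P _ X n _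
    (@measurable_qform _ _ _ P _ X _ (cmeasurable_truncate K) n B)).
apply: le_trans (lee_wpmul2l _ H) _; first by rewrite lee_fin expR_ge0.
rewrite -EFinM -expRD lee_fin ler_expR rtrace_herm_part.
have h1 : 18 * K ^+ 2 * frob2 n B <=
    18 * K ^+ 2 * (lam ^+ 2 * frobenius_norm A ^+ 2).
  by rewrite ler_wpM2l ?frob2_herm_part//; lra.
have h2 : n%:R * (e3 + e2 ^+ 2 + e2 ^+ 2 / 2) <= n%:R * (e2 + e3).
  by rewrite ler_wpM2l//; lra.
lra.
Qed.

Let half_le_ReIm (x y r : R) : 0 < r -> r <= Num.sqrt (x ^+ 2 + y ^+ 2) ->
  [|| r / 2 <= x, r / 2 <= - x, r / 2 <= y | r / 2 <= - y].
Proof.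
move=> r0; apply: contraLR; rewrite !negb_or -!ltNge => /and4P[x1 x2 y1 y2].
rewrite -(@ltr_pXn2r _ 2) ?nnegrE ?sqrtr_ge0 ?ltW// sqr_sqrtr; last first.
  by rewrite addr_ge0// sqr_ge0.
nra.
Qed.

Lemma measure_bigsetU_le I (r : seq I) (F : I -> set T) :
  (forall i, measurable (F i)) ->
  (P (\big[setU/set0]_(i <- r) F i) <= \sum_(i <- r) P (F i))%E.
Proof.
move=> mF; elim: r => [|i r IH]; first by rewrite !big_nil measure0.
rewrite !big_cons; apply: le_trans (leeD2l _ IH).
by apply: measureU2 => //; exact: bigsetU_measurable.
Qed.

Lemma in_bigsetU (I : eqType) (r : seq I) (F : I -> set T) i w :
  i \in r -> F i w -> (\big[setU/set0]_(j <- r) F j) w.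
Proof.
elim: r => // j r IH; rewrite in_cons big_cons => /predU1P[->|ir] Fw.
  by left.
by right; exact: IH.
Qed.

Lemma measurable_cabs_gt i : measurable [set w | K < cabs (X i w)].
Proof.
rewrite (_ : mkset _ = X i @^-1` (~` [set z | cabs z <= K])).
  rewrite -[X in measurable X]setTI; apply: measurable_funPT => //.
  by apply: measurableC; exact: measurable_cabs_le.
by apply/seteqP; split => w /=; rewrite ltNge => /negP.
Qed.

Lemma exceed_truncation :
  (P (\big[setU/set0]_(i < n) [set w | (K < cabs (X i w))%R]) <=
   (n%:R * eps1 P X K)%:E)%E.
Proof.
apply: (le_trans (measure_bigsetU_le _ measurable_cabs_gt)).
have -> : n%:R * eps1 P X K = \sum_(i < n) eps1 P X K.
  by rewrite sumr_const card_ord mulr_natl.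
rewrite -sumEFin; apply: lee_sum => i _.
rewrite -[leLHS]fineK ?fin_num_measure//; last exact: measurable_cabs_gt.
rewrite lee_fin.
exact: (le_bigmax _ (fun i => fine (P [set w | K < cabs (X i w)]))).
Qed.

(** Off the event that some coordinate exceeds K truncation changes nothing, and
    a complex number of modulus at least r has real or imaginary part of
    absolute value at least r / 2. *)
Lemma hanson_wright_truncated (A : 'M[R[i]]_n) (lam r : R) :
  0 < r -> 0 <= lam -> lam * spectral_norm A <= (72 * K ^+ 2)^-1 ->
  (P [set w | (r <= cabs (quad_form A (\col_i X i w) - \tr A))%R] <=
   (4 * expR (18 * K ^+ 2 * (lam ^+ 2 * frobenius_norm A ^+ 2) - lam * (r / 2)
          + n%:R * (e2 + e3)) + n%:R * eps1 P X K)%:E)%E.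
Proof.
move=> r0 lam0 lamA.
pose D (v : 'I_n -> T -> R[i]) w := quad_form A (\col_i v i w) - \tr A.
have mD v : (forall i, cmeasurable_fun (v i)) -> cmeasurable_fun (D v).
  move=> mv; apply: cmeasurableD; last exact: cmeasurable_cst.
  exact: measurable_quad_form.
have mX i : cmeasurable_fun (X i).
  exact: (cmeasurable_comp (@measurable_funPT _ _ _ _ (X i)) (@cmeasurable_id R)).
pose E (o : R[i]) := [set w | r / 2 <= Re (o * D Y w)].
have mE o : measurable (E o).
  have [mRe _] := cmeasurableM (cmeasurable_cst o) (mD Y mY).
  rewrite (_ : E o = (fun w => Re (o * D Y w)) @^-1` `[r / 2, +oo[).
    by rewrite -[X in measurable X]setTI; exact: mRe.
  by apply/seteqP; split => w /=; rewrite in_itv /= andbT.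
pose os : seq R[i] := [:: 1; -1; 'i%C; - 'i%C].
pose bad := \big[setU/set0]_(i < n) [set w | (K < cabs (X i w))%R].
have mbad : measurable bad.
  by apply: bigsetU_measurable => i _; exact: measurable_cabs_gt.
apply: (@le_trans _ _ (P (\big[setU/set0]_(o <- os) E o `|` bad))).
  apply: le_measure; rewrite ?inE.
  - have mDX := measurable_sqmod (mD (fun i => X i) mX).
    rewrite (_ : mkset _ = (fun w => sqmod (D (fun i => X i) w)) @^-1` `[r ^+ 2, +oo[).
      by rewrite -[X in measurable X]setTI; exact: mDX.
    apply/seteqP; split => w /=; rewrite in_itv /= andbT -cabs_sqr.
      by move=> rD; apply: lerXn2r; rewrite ?nnegrE ?cabs_ge0 ?(ltW r0).
    by rewrite ler_pXn2r ?nnegrE ?cabs_ge0 ?(ltW r0).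
  - by apply: measurableU => //; exact: bigsetU_measurable.
  - move=> w /= rw; have [|good] := pselect (bad w); first by right.
    left; have {rw} : r <= cabs (D Y w); last first.
      case DE: (D Y w) => [x y] /(half_le_ReIm r0)/or4P[] h.
      - apply: (@in_bigsetU _ _ _ 1); rewrite ?inE ?eqxx//.
        by rewrite /E /= DE mul1r.
      - apply: (@in_bigsetU _ _ _ (- 1)); rewrite ?inE ?eqxx ?orbT//.
        by rewrite /E /= DE mulN1r.
      - apply: (@in_bigsetU _ _ _ (- 'i%C)); rewrite ?inE ?eqxx ?orbT//.
        by rewrite /E /= DE /=; lra.
      - apply: (@in_bigsetU _ _ _ 'i%C); rewrite ?inE ?eqxx ?orbT//.
        by rewrite /E /= DE /=; lra.
    rewrite /D; have <- // : \col_i X i w = \col_i Y i w.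
      apply/matrixP => i j; rewrite !mxE /Y truncate_id// leNgt; apply/negP => KX.
      by apply: good; apply: (in_bigsetU (mem_index_enum i)).
apply: (@le_trans _ _ (P (\big[setU/set0]_(o <- os) E o) + P bad)%E).
  by apply: measureU2 => //; exact: bigsetU_measurable.
rewrite EFinD; apply: leeD; last exact: exceed_truncation.
apply: (le_trans (measure_bigsetU_le _ mE)).
rewrite !big_cons big_nil adde0.
set e := expR _.
have tb o : sqmod o = 1 -> (P (E o) <= e%:E)%E.
  by move=> o1; exact: truncated_chernoff.
rewrite (_ : 4 * e = e + (e + (e + e))); last by ring.
rewrite !EFinD.
have s1 : sqmod (1 : R[i]) = 1 by rewrite /sqmod /= expr1n expr0n addr0.
have si : sqmod ('i%C : R[i]) = 1 by rewrite /sqmod /= expr1n expr0n add0r.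
have sN z : sqmod (- z) = sqmod z :> R by case: z => x y; rewrite /sqmod /= !sqrrN.
by do 3 ?[apply: leeD]; apply: tb; rewrite ?sN.
Qed.

End chernoff.
End tail_bound.

(** The exponent 18 K^2 lam^2 F^2 - lam t / 2 is to be minimised under the
    constraint lam S <= 1 / (72 K^2).  With this lam the quadratic term is at
    most lam t / 4, which leaves - lam t / 4 and explains 288 = 4 * 72.  Inverses
    of zero are zero, so F = 0 or S = 0 gives lam = 0, for which the claims
    hold as well. *)
Lemma chernoff_parameter (R : realType) (K F S L t : R) : 1 < K -> 0 <= S ->
  1 <= L -> 0 < t ->
  let lam := (72 * K ^+ 2)^-1 * Num.min (t / F ^+ 2) S^-1 in
  [/\ 0 <= lam, lam * S <= (72 * K ^+ 2)^-1 &
    18 * K ^+ 2 * (lam ^+ 2 * F ^+ 2) - lam * (t / 2) <=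
    - (288^-1 * K ^- 2 * Num.min (t ^+ 2 / (F ^+ 2 * L)) (t / S))].
Proof.
move=> K1 S0 L1 t0 lam.
set m := Num.min (t / F ^+ 2) S^-1 in lam *.
have Kn0 : K != 0 by rewrite lt0r_neq0//; lra.
have K2 : 0 < K ^+ 2 by rewrite exprn_gt0//; lra.
have c0 : 0 < (72 * K ^+ 2)^-1 by rewrite invr_gt0; lra.
have m0 : 0 <= m.
  by rewrite /m le_min invr_ge0 S0 andbT divr_ge0 ?sqr_ge0// ltW.
have lam0 : 0 <= lam by rewrite mulr_ge0// ltW.
have mS : m * S <= 1.
  apply: (@le_trans _ _ (S^-1 * S)); first by rewrite ler_wpM2r// ge_min lexx orbT.
  by have [->|S1] := eqVneq S 0; rewrite ?mulr0// mulVf.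
have mF : m * F ^+ 2 <= t.
  apply: (@le_trans _ _ (t / F ^+ 2 * F ^+ 2)).
    by rewrite ler_wpM2r ?sqr_ge0// ge_min lexx.
  have [->|F1] := eqVneq (F ^+ 2) 0; first by rewrite mulr0 ltW.
  by rewrite divfK.
have mt : Num.min (t ^+ 2 / (F ^+ 2 * L)) (t / S) <= m * t.
  rewrite /m minr_pMl ?(ltW t0)// le_min !ge_min; apply/andP; split; apply/orP.
    left; rewrite [leRHS]mulrAC -expr2 invfM mulrA -[leRHS]mulr1.
    rewrite ler_wpM2l ?divr_ge0 ?sqr_ge0// invf_le1//; lra.
  by right; rewrite mulrC.
split => //.
  by rewrite /lam -mulrA -[leRHS]mulr1 ler_wpM2l// ltW.
have lamF : 18 * K ^+ 2 * (lam ^+ 2 * F ^+ 2) <= lam * (t / 4).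
  rewrite [leLHS](_ : _ = lam * (18 * K ^+ 2 * (72 * K ^+ 2)^-1) * (m * F ^+ 2));
    last by rewrite /lam; ring.
  rewrite (_ : 18 * K ^+ 2 * (72 * K ^+ 2)^-1 = 1 / 4); last by field.
  have : lam * (m * F ^+ 2) <= lam * t by rewrite ler_wpM2l.
  lra.
have -> : 288^-1 * K ^- 2 = (72 * K ^+ 2)^-1 / 4 by field.
have : (72 * K ^+ 2)^-1 * Num.min (t ^+ 2 / (F ^+ 2 * L)) (t / S) <= lam * t.
  by rewrite /lam -mulrA ler_wpM2l// ltW.
lra.
Qed.

Theorem theorem1p5 (R : realType) :
  exists C C' : R, [/\ 0 < C, 0 < C' &
    forall (d : nat -> measure_display) (T : forall n, measurableType (d n))
      (P : forall n, probability (T n) R)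
      (X : forall n, 'I_n -> {RV (P n) >-> R[i]}) (K : nat -> R),
    (forall n, independent_RVs (X n)) ->
    (forall n (i : 'I_n), cexpectation (P n) (X n i) = 0) ->
    (forall n (i : 'I_n), cvariance (P n) (X n i) = 1%E) ->
    (forall n, 1 < K n) ->
    (forall n, [/\ eps1 (P n) (X n) (K n) <= 1 / 2,
                   eps2 (P n) (X n) (K n) <= 1 / 2 &
                   eps3 (P n) (X n) (K n) <= 1 / 2]) ->
    (n%:R ^+ 2 * K n ^+ 2 *
      (eps2 (P n) (X n) (K n) + eps3 (P n) (X n) (K n))) @[n --> \oo]
      --> (0 : R) ->
    \forall n \near \oo, forall (A : 'M[R[i]]_n) (t : R), A != 0 -> 0 < t ->
      (P n [set w | (t <= cabs (quad_form A (\col_i X n i w) - \tr A))%R] <=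
       (C * ln n%:R *
          expR (- (C' * K n ^- 2 *
            Num.min (t ^+ 2 / (frobenius_norm A ^+ 2 * ln n%:R))
                    (t / spectral_norm A)))
        + n%:R * eps1 (P n) (X n) (K n))%:E)%E].
Proof.
exists (4 * expR 1), 288^-1; split; [by rewrite mulr_gt0// expR_gt0|by rewrite invr_gt0|].
move=> d T P X K indX _ _ K1 eps_half eps_small.
have eventually_small := cvgr_lt _ eps_small _ ltr01.
near=> n; move=> A t _ t0.
have n_large : expR 1 <= n%:R :> R by near: n; exact: nbhs_infty_ger.
have n1 : 1 <= n%:R :> R by have := expR_ge1Dx (1 : R); lra.
have ln1 : 1 <= ln n%:R :> R.
  by rewrite -[leLHS]expRK ler_ln// posrE ?expR_gt0//; lra.
have small : n%:R ^+ 2 * K n ^+ 2 *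
    (eps2 (P n) (X n) (K n) + eps3 (P n) (X n) (K n)) < 1.
  by near: n; exact: eventually_small.
have [_ e2h e3h] := eps_half n.
set e2 := eps2 _ _ _ in e2h small *; set e3 := eps3 _ _ _ in e3h small *.
have e20 : 0 <= e2.
  by rewrite /e2 /eps2; elim/big_rec: _ => // i x _ x0; rewrite le_max x0 orbT.
have e30 : 0 <= e3.
  by rewrite /e3 /eps3; elim/big_rec: _ => // i x _ x0; rewrite le_max x0 orbT.
(* The accumulated error in means and variances costs a factor e. *)
have drift : n%:R * (e2 + e3) <= 1.
  apply: le_trans (ltW small); rewrite ler_wpM2r ?addr_ge0//.
  rewrite -[leLHS]mulr1; apply: ler_pM => //; first by rewrite ler_eXnr.
  by apply: exprn_ege1; exact: ltW.
have := chernoff_parameter (frobenius_norm A) (K1 n) (spectral_norm_ge0 A) ln1 t0.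
set lam := _ * _; set m := Num.min _ _ => -[lam0 lamA exponent].
apply: (le_trans (hanson_wright_truncated (indX n) (K1 n) (lexx e2) (lexx e3)
  e2h e3h t0 lam0 lamA)).
rewrite lee_fin lerD2r; set bound := expR (- _).
apply: (@le_trans _ _ (4 * (expR 1 * bound))).
  by rewrite ler_pM2l// -expRD ler_expR; lra.
rewrite [leRHS](_ : _ = ln n%:R * (4 * (expR 1 * bound))); last by ring.
by rewrite ler_peMl// !mulr_ge0 ?expR_ge0.
Unshelve. all: by end_near.
Qed.
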